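(* Let $(X,b,\mu)$ be a connected weighted graph satisfying the finiteness condition (FC). Let $V=V_1+V_2$, where $V_1,V_2\in C(X)$ are real-valued, $V_2(x)\geq 0$ for all $x\in X$, and assume that there exists $C\in\mathbb{R}$ such that $(\mathcal{L}_{V_1}u,u)\geq C\|u\|^2$ for all $u\in C_c(X)$. Let $L_{V_1}$ and $L_V$ be the Friedrichs extensions of $\mathcal{L}_{V_1}|_{C_c(X)}$ and $\mathcal{L}_{V}|_{C_c(X)}$ respectively, and let $M_{V_2}$ be the maximal multiplication operator in $\ell^2_\mu(X)$ corresponding to $V_2$. Then the form-sum $L_{V_1}\widetilde{+}M_{V_2}$ coincides with $L_V$.
   Context: A symmetric weighted graph $(X,b)$ is a countable set $X\neq\emptyset$ with a function $b\colon X\times X\to[0,\infty)$ such that $b(x,y)=b(y,x)$, $b(x,x)=0$ and $\sum_{z\in X}b(x,z)<\infty$ for all $x,y\in X$. Write $x\sim y$ if $b(x,y)>0$; the graph is connected if every two vertices $x,y$ can be joined by a finite path $x=x_0\sim x_1\sim\dots\sim x_n=y$. A weight is a function $\mu\colon X\to(0,\infty)$; $(X,b,\mu)$ is called a weighted graph. $C(X)$ is the set of all functions $X\to\mathbb{C}$, $C_c(X)$ the set of finitely supported ones. $\ell^2_\mu(X)$ is the Hilbert space of $f\in C(X)$ with $\sum_x\mu(x)|f(x)|^2<\infty$, with inner product $(f,g)=\sum_x\mu(x)f(x)\overline{g(x)}$ and norm $\|\cdot\|$. Finiteness condition (FC): for every $x\in X$ the function $y\mapsto b(x,y)/\mu(y)$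 belongs to $\ell^2_\mu(X)$. For real-valued $V\in C(X)$, the formal Schrödinger operator $\mathcal{L}_V$ is defined on $\mathcal{F}=\{f\in C(X): \sum_{y}b(x,y)|f(y)|<\infty \text{ for all } x\in X\}$ by $\mathcal{L}_Vf(x)=\frac{1}{\mu(x)}\sum_{y\in X}b(x,y)(f(x)-f(y))+V(x)f(x)$. Under (FC), $\mathcal{L}_V$ maps $C_c(X)$ into $\ell^2_\mu(X)$ and $\mathcal{L}_V|_{C_c(X)}$ is a symmetric operator in $\ell^2_\mu(X)$. If it is lower semi-bounded, the quadratic form $u\mapsto(\mathcal{L}_Vu,u)$ with domain $C_c(X)$ is closable, and its Friedrichs extension $L_V$ is the self-adjoint operator associated to the closure of this form. (Since $V_2\ge0$, lower semi-boundedness of $\mathcal{L}_{V_1}|_{C_c(X)}$ implies that of $\mathcal{L}_{V_1+V_2}|_{C_c(X)}$.) The maximal multiplication operator is $M_{V_2}u=V_2u$ with domain $\{u\in\ell^2_\mu(X): V_2u\in\ell^2_\mu(X)\}$; it is the self-adjoint operator associated to the closed non-negative form $q_{V_2}(u)=\sum_x\mu(x)V_2(x)|u(x)|^2$ with domain $\{u\in\ell^2_\mu(X):\sum_x\mu(x)V_2(x)|u(x)|^2<\infty\}$. Let $h_1$ be the closure of the form $u\mapsto(\mathcal{L}_{V_1}u,u)$, $u\in C_c(X)$ (the form of $L_{V_1}$). The form-sum $L_{V_1}\widetilde{+}M_{V_2}$ is the self-adjoint operator associated to the closed lower semi-bounded form $h_1+q_{V_2}$, whose domain is the intersection of the domains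 of $h_1$ and $q_{V_2}$. *)

(* Defs.v *)
From HB Require Import structures.
From mathcomp Require Import all_boot all_order all_algebra.
From mathcomp Require Import all_classical all_reals all_analysis.
From mathcomp Require Import complex.

Set Implicit Arguments.
Unset Strict Implicit.
Unset Printing Implicit Defensive.

Import Order.TTheory GRing.Theory Num.Theory.
Import numFieldNormedType.Exports.
Local Open Scope classical_set_scope.
Local Open Scope complex_scope.
Local Open Scope ring_scope.

(* Sums over a countable index type. These are the unconditional sums of
   absolutely summable families; on other families the value is meaningless. *)
Definition rsum (R : realType) (X : countType) (f : X -> R) : R :=
  fine (\esum_(x in [set: X]) ((EFin \o f)^\+ x)
        - \esum_(x in [set: X]) ((EFin \o f)^\- x))%E.

Definition csum (R : realType) (X : countType) (f : X -> R[i]) : R[i] :=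
  rsum (fun x => complex.Re (f x)) +i* rsum (fun x => complex.Im (f x)).

Record weighted_graph (R : realType) (X : countType)
    (b : X -> X -> R) (mu : X -> R) : Prop := WeightedGraph {
  wg_nonempty : [set: X] !=set0;
  wg_ge0 : forall x y, 0 <= b x y;
  wg_sym : forall x y, b x y = b y x;
  wg_diag : forall x, b x x = 0;
  wg_summable : forall x, summable [set: X] (EFin \o b x);
  wg_weight_gt0 : forall x, 0 < mu x }.

Definition connected_graph (R : realType) (X : countType) (b : X -> X -> R) :=
  forall x y, exists p : seq X,
    path (fun u v => 0 < b u v) x p /\ last x p = y.

Section ell2.
Context (R : realType) (X : countType) (mu : X -> R).

Definition ell2 : set (X -> R[i]) :=
  [set f | summable [set: X] (fun x => (mu x * ComplexField.Normc.normc (f x) ^+ 2)%:E)].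

Definition inner (f g : X -> R[i]) : R[i] :=
  csum (fun x => (mu x)%:C * f x * (g x)^*).

Definition ell2_norm (f : X -> R[i]) : R :=
  Num.sqrt (rsum (fun x => mu x * ComplexField.Normc.normc (f x) ^+ 2)).

End ell2.

Definition Cc (R : realType) (X : countType) : set (X -> R[i]) :=
  [set f | finite_set [set x | f x != 0]].

Definition finiteness_condition (R : realType) (X : countType)
    (b : X -> X -> R) (mu : X -> R) :=
  forall x, ell2 mu (fun y => (b x y / mu y)%:C).

(* Meaningful when [\sum_y b x y * |f y|] is finite for all x, in particular
   on Cc. *)
Definition schrodinger (R : realType) (X : countType) (b : X -> X -> R)
    (mu V : X -> R) (f : X -> R[i]) : X -> R[i] := fun x =>
  ((mu x)^-1)%:C * csum (fun y => (b x y)%:C * (f x - f y)) + (V x)%:C * f x.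

(* Sesquilinear forms in ell2, linear in the first argument; the values outside
   the domain are irrelevant. *)
Record sform (R : realType) (X : countType) := SForm {
  fdom : set (X -> R[i]);
  fval : (X -> R[i]) -> (X -> R[i]) -> R[i] }.

(* Operators in ell2 are represented by their graphs. *)
Definition operator (R : realType) (X : countType) :=
  set ((X -> R[i]) * (X -> R[i])).

Section forms.
Context (R : realType) (X : countType) (mu : X -> R).
Implicit Types (q : sform R X) (u v : X -> R[i]) (s t : nat -> X -> R[i]).

Definition form_cvg q s u :=
  [/\ ell2 mu u, forall n, fdom q (s n),
      ell2_norm mu (s n - u) @[n --> \oo] --> (0 : R)
    & fval q (s p.1 - s p.2) (s p.1 - s p.2) @[p --> (\oo, \oo)]
        --> (0 : R[i]^o)].

Record closed_form q : Prop := ClosedForm {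
  cf_ell2 : fdom q `<=` ell2 mu;
  cf_dom0 : fdom q 0;
  cf_domP : forall (a : R[i]) u v,
    fdom q u -> fdom q v -> fdom q (fun x => a * u x + v x);
  cf_linear : forall (a : R[i]) u v w, fdom q u -> fdom q v -> fdom q w ->
    fval q (fun x => a * u x + v x) w = a * fval q u w + fval q v w;
  cf_herm : forall u v, fdom q u -> fdom q v -> fval q v u = (fval q u v)^*;
  cf_bounded : exists c : R, forall u, fdom q u ->
    (c * ell2_norm mu u ^+ 2)%:C <= fval q u u;
  cf_dense : forall u, ell2 mu u -> forall e : R, 0 < e ->
    exists2 v, fdom q v & ell2_norm mu (u - v) < e;
  cf_closed : forall s u, form_cvg q s u ->
    fdom q u /\ fval q (s n - u) (s n - u) @[n --> \oo] --> (0 : R[i]^o) }.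

(* The value is well defined exactly when q is closable. *)
Definition form_closure q : sform R X :=
  {| fdom := [set u | exists s, form_cvg q s u];
     fval := fun u v => xget 0 [set z : R[i] | exists s t,
       [/\ form_cvg q s u, form_cvg q t v
         & fval q (s n) (t n) @[n --> \oo] --> (z : R[i]^o)]] |}.

Definition form_add q1 q2 : sform R X :=
  {| fdom := fdom q1 `&` fdom q2;
     fval := fun u v => fval q1 u v + fval q2 u v |}.

Definition form_operator q : operator R X :=
  [set uw | [/\ fdom q uw.1, ell2 mu uw.2
    & forall v, fdom q v -> fval q uw.1 v = inner mu uw.2 v]].

(* A self-adjoint lower semi-bounded operator is associated to exactly one closed
   form, so qA and qB below are the forms of A and B, and the form-sum is the
   operator associated to qA + qB. For a Friedrichs extension qA is the closure
   of the minimal form; for multiplication by V >= 0, qB is the form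
   [\sum_x mu x * V x * u x * (v x)^*] on its maximal domain. *)
Definition form_sum (A B : operator R X) : operator R X :=
  [set uw | exists qA qB,
    [/\ closed_form qA /\ form_operator qA = A,
        closed_form qB /\ form_operator qB = B
      & form_operator (form_add qA qB) uw]].

Definition mult_operator (V : X -> R) : operator R X :=
  [set uw | [/\ ell2 mu uw.1, ell2 mu uw.2
    & uw.2 = (fun x => (V x)%:C * uw.1 x)]].

End forms.

Definition schrodinger_form (R : realType) (X : countType) (b : X -> X -> R)
    (mu V : X -> R) : sform R X :=
  {| fdom := @Cc R X;
     fval := fun u v => inner mu (schrodinger b mu V u) v |}.

Definition friedrichs (R : realType) (X : countType) (b : X -> X -> R)
    (mu V : X -> R) : operator R X :=
  form_operator mu (form_closure mu (schrodinger_form b mu V)).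

(* Main.v *)
Require Import Defs.
From mathcomp Require Import all_boot all_order all_algebra.
From mathcomp Require Import all_classical all_reals all_analysis.
From mathcomp Require Import finmap complex.
From mathcomp Require Import ring lra.

Set Implicit Arguments.
Unset Strict Implicit.
Unset Printing Implicit Defensive.

Import Order.TTheory GRing.Theory Num.Theory.
Import numFieldNormedType.Exports.
Local Open Scope classical_set_scope.
Local Open Scope complex_scope.
Local Open Scope ring_scope.

(** Let [h1] be the closure of the form of [V1] on finitely supported functions,
    [q2] the form of multiplication by [V2], and [h] the closure of the form of
    [V = V1 + V2].

    A self-adjoint semibounded operator determines its closed form
    ([closed_form_unique]): the two forms agree on the domain of the operator,
    which is a core of each of them because resolvent approximations do not
    increase the energy ([op_domain_core]). The forms hidden in the form sum are
    thus [h1] and [q2], which are closed ([closure_closed], [mult_form_closed]),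
    and it remains to see that [h = h1 + q2], domains included
    ([closure_form_add]).

    On finitely supported functions the form of [V] is the sum of the form of
    [V1] and [q2], and both are bounded below. A sequence that is Cauchy for the
    sum is therefore Cauchy for both, so the domain of [h] lies in those of [h1]
    and [q2], and the values add up ([form_cvg_split]).

    For the converse inclusion, [u] in both domains has to be approximated by
    finitely supported functions. It is enough to find approximations in l^2
    with bounded energy ([bounded_energy_form_cvg]). Let [f] and [g] be finitely
    supported and close to [u] for the form [h1], and let [v] be [g] truncated to
    the modulus of [f], that is [v = g * min(1, |f| / |g|)]. Then [v] is close to
    [u] in l^2, and its two energies are bounded for different reasons. Since
    [v] lives on the finite support of [f] and [|v| <= |g|], its energy for [V2]
    is controlled by [q2 u] once [g] is close enough to [u], depending on [f].
    Its energy for [V1] is controlled by the inequality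
    [E v + E (max(|f|, |g|)) <= E f + E g] for the energy [E]
    ([truncation_energy]), which holds for every real potential and is useful
    because [E] is bounded below. The edge terms in it reduce to the
    rearrangement inequality for two pairs of nonnegative numbers
    ([form_sum_dom_closure]). *)

(** * Complex numbers and limits *)

Section ComplexNumbers.
Context {R : rcfType}.
Implicit Types z w : R[i].

Lemma conj_complexE z : z^* = complex.Re z -i* complex.Im z.
Proof. by case: z. Qed.

Lemma cReD z w : complex.Re (z + w) = complex.Re z + complex.Re w.
Proof. by case: z; case: w. Qed.

Lemma cImD z w : complex.Im (z + w) = complex.Im z + complex.Im w.
Proof. by case: z; case: w. Qed.

Lemma cReN z : complex.Re (- z) = - complex.Re z.
Proof. by case: z. Qed.

Lemma cImN z : complex.Im (- z) = - complex.Im z.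
Proof. by case: z. Qed.

Lemma cReM z w :
  complex.Re (z * w) = complex.Re z * complex.Re w - complex.Im z * complex.Im w.
Proof. by case: z; case: w. Qed.

Lemma cImM z w :
  complex.Im (z * w) = complex.Re z * complex.Im w + complex.Im z * complex.Re w.
Proof. by case: z; case: w. Qed.

Lemma cReJ z : complex.Re z^* = complex.Re z.
Proof. by case: z. Qed.

Lemma cImJ z : complex.Im z^* = - complex.Im z.
Proof. by case: z. Qed.

Lemma cReMr (a : R) z : complex.Re (a%:C * z) = a * complex.Re z.
Proof. by rewrite cReM /= mul0r subr0. Qed.

Definition cReImE := (cReD, cImD, cReN, cImN, cReM, cImM, cReJ, cImJ).

Lemma complex_eq z w :
  complex.Re z = complex.Re w -> complex.Im z = complex.Im w -> z = w.
Proof. by case: z => a b; case: w => c d /= -> ->. Qed.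

Lemma sqr_normcE z :
  ComplexField.Normc.normc z ^+ 2 = complex.Re z ^+ 2 + complex.Im z ^+ 2.
Proof. by case: z => a b /=; rewrite sqr_sqrtr// addr_ge0// sqr_ge0. Qed.

End ComplexNumbers.

Section Limits.
Context {R : realType}.

Lemma cvg0_seqP (a : nat -> R) : a n @[n --> \oo] --> (0 : R) <->
  forall e, 0 < e -> exists N, forall n, (N <= n)%N -> `|a n| < e.
Proof.
split.
  move=> /cvgrPdist_lt h e e0; have [N _ hN] := h e e0.
  by exists N => n Nn; move: (hN n Nn) => /=; rewrite sub0r normrN.
move=> h; apply/cvgrPdist_lt => e e0; have [N hN] := h e e0.
by exists N => // n /= Nn; rewrite sub0r normrN hN.
Qed.

Lemma cvg0_seq2P (a : nat * nat -> R) : a p @[p --> (\oo, \oo)] --> (0 : R) <->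
  forall e, 0 < e -> exists N, forall n m, (N <= n)%N -> (N <= m)%N ->
    `|a (n, m)| < e.
Proof.
split.
  move=> /cvgrPdist_lt h e e0.
  have [[A B] /= [[N1 _ hN1] [N2 _ hN2]] AB] := h e e0.
  exists (maxn N1 N2) => n m; rewrite !geq_max => /andP[n1 n2] /andP[m1 m2].
  have /= := AB (n, m); rewrite sub0r normrN; apply; split => /=.
    exact: hN1.
  exact: hN2.
move=> h; apply/cvgrPdist_lt => e e0; have [N hN] := h e e0.
exists ([set n | (N <= n)%N], [set n | (N <= n)%N]).
  by split; exists N.
by move=> [n m] /= [Nn Nm]; rewrite sub0r normrN hN.
Qed.

Lemma cauchy_seq_cvg (a : nat -> R) :
  (a p.1 - a p.2) @[p --> (\oo, \oo)] --> (0 : R) ->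
  exists l, a n @[n --> \oo] --> (l : R).
Proof.
move=> /cvg0_seq2P h.
suff: cvgn a by move=> ac; exists (limn a).
apply/cauchy_cvgP/cauchy_ballP => e e0; have [N hN] := h e e0.
exists (a @` [set n | (N <= n)%N], a @` [set n | (N <= n)%N]).
  by split; exists N => // n /= Nn; exists n.
by move=> [_ _] /= [[n Nn <-] [m Nm <-]]; exact: hN.
Qed.

Lemma cvg_complexP (T : Type) (F : set_system T) {FF : Filter F}
    (a : T -> R[i]) (z : R[i]) :
  a t @[t --> F] --> (z : R[i]^o) <->
  complex.Re (a t) @[t --> F] --> complex.Re z /\
  complex.Im (a t) @[t --> F] --> complex.Im z.
Proof.
have distE w : (`|w : R[i]^o| = (ComplexField.Normc.normc w)%:C)%R by case: w.
split.
  move=> /(@cvgrPdist_lt _ R[i]^o) h; split; apply/cvgrPdist_lt => e e0;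
    (have he : 0 < e%:C :> R[i] by rewrite ltcR);
    apply: filterS (h _ he) => t; rewrite distE ltcR; apply: le_lt_trans.
    rewrite -[X in X <= _]sqrtr_sqr -cReN -cReD.
    case: (z - a t) => x y /=; rewrite ler_wsqrtr// lerDl sqr_ge0//.
  rewrite -[X in X <= _]sqrtr_sqr -cImN -cImD.
  case: (z - a t) => x y /=; rewrite ler_wsqrtr// lerDr sqr_ge0//.
move=> [/cvgrPdist_lt hR /cvgrPdist_lt hI].
apply/(@cvgrPdist_lt _ R[i]^o) => eps; rewrite ltcE => /andP[/eqP eps_im].
have -> : eps = (complex.Re eps)%:C by apply: complex_eq.
move: (complex.Re eps) => {eps eps_im} e e0.
have e2 : 0 < e / 2 by rewrite divr_gt0.
apply: filterS2 (hR _ e2) (hI _ e2) => t.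
rewrite -cReN -cReD -cImN -cImD distE ltcR.
case: (z - a t) => x y /= hx hy.
rewrite -[X in _ < X]ger0_norm ?(ltW e0)// -sqrtr_sqr ltr_sqrt ?exprn_gt0//.
rewrite -[x ^+ 2]real_normK ?num_real// -[y ^+ 2]real_normK ?num_real//.
have ? := normr_ge0 x; have ? := normr_ge0 y; nra.
Qed.

Lemma cvg0_complex_realP (T : Type) (F : set_system T) {FF : Filter F}
    (a : T -> R[i]) : (forall t, complex.Im (a t) = 0) ->
  a t @[t --> F] --> (0 : R[i]^o) <->
  complex.Re (a t) @[t --> F] --> (0 : R).
Proof.
move=> a0; rewrite cvg_complexP; split=> [[]//|h]; split=> //.
by rewrite (_ : (fun t => _) = cst 0) ?funeqE//; exact: cvg_cst.
Qed.

Lemma cvg0_le (T : Type) (F : set_system T) {FF : Filter F} (a b : T -> R) :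
  (forall t, 0 <= a t) -> (forall t, a t <= b t) ->
  b t @[t --> F] --> (0 : R) -> a t @[t --> F] --> (0 : R).
Proof.
move=> a0 ab hb; apply: (squeeze_cvgr _ (cvg_cst 0) hb).
by apply: nearW => t; rewrite a0 ab.
Qed.

Lemma cvg0_sqrt (T : Type) (F : set_system T) {FF : Filter F} (a : T -> R) :
  a t @[t --> F] --> (0 : R) -> Num.sqrt (a t) @[t --> F] --> (0 : R).
Proof.
move=> h; rewrite -[X in _ --> X](@sqrtr0 R).
by apply: cvg_comp h _; exact: sqrt_continuous.
Qed.

Lemma cvg0_sqr (T : Type) (F : set_system T) {FF : Filter F} (a : T -> R) :
  a t @[t --> F] --> (0 : R) -> a t ^+ 2 @[t --> F] --> (0 : R).
Proof. by move=> h; rewrite -[X in _ --> X](mulr0 (0 : R)); exact: cvgM. Qed.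

End Limits.

(** * Hermitian forms *)

(** A sesquilinear hermitian form [B], of which only the values on the subspace
    [K] matter. *)
Record herm_form {R : rcfType} {E : lmodType R[i]} (K : set E)
    (B : E -> E -> R[i]) : Prop := HermForm {
  herm_dom0 : K 0;
  herm_domP : forall a u v, K u -> K v -> K (a *: u + v);
  herm_linear : forall a u v w, K u -> K v -> K w ->
    B (a *: u + v) w = a * B u w + B v w;
  herm_sym : forall u v, K u -> K v -> B v u = (B u v)^* }.

Definition qform {R : rcfType} {E : lmodType R[i]} (B : E -> E -> R[i]) (u : E) : R :=
  complex.Re (B u u).

Section HermitianForms.
Context {R : rcfType} {E : lmodType R[i]} {K : set E} {B : E -> E -> R[i]}.
Hypothesis hB : herm_form K B.
Implicit Types (u v w : E) (a : R[i]).
Local Notation Q := (qform B).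

Lemma herm_domD u v : K u -> K v -> K (u + v).
Proof. by move=> Ku Kv; rewrite -[u]scale1r; exact: (herm_domP hB). Qed.

Lemma herm_domZ a u : K u -> K (a *: u).
Proof.
by move=> Ku; rewrite -[_ *: _]addr0; apply: (herm_domP hB) => //; case: hB.
Qed.

Lemma herm_domB u v : K u -> K v -> K (u - v).
Proof. by move=> Ku Kv; rewrite addrC -scaleN1r; exact: (herm_domP hB). Qed.

Lemma hermDl u v w : K u -> K v -> K w -> B (u + v) w = B u w + B v w.
Proof.
move=> Ku Kv Kw.
by have := herm_linear hB 1 Ku Kv Kw; rewrite scale1r mul1r.
Qed.

Lemma herm0l w : K w -> B 0 w = 0.
Proof.
move=> Kw; have := hermDl (herm_dom0 hB) (herm_dom0 hB) Kw.
by rewrite addr0 => /eqP; rewrite -subr_eq subrr => /eqP <-.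
Qed.

Lemma hermZl a u w : K u -> K w -> B (a *: u) w = a * B u w.
Proof.
move=> Ku Kw; have := herm_linear hB a Ku (herm_dom0 hB) Kw.
by rewrite addr0 herm0l// addr0.
Qed.

Lemma hermBl u v w : K u -> K v -> K w -> B (u - v) w = B u w - B v w.
Proof.
by move=> Ku Kv Kw; rewrite addrC -scaleN1r (herm_linear hB)// mulN1r addrC.
Qed.

Lemma hermDr u v w : K u -> K v -> K w -> B w (u + v) = B w u + B w v.
Proof.
move=> Ku Kv Kw; rewrite (herm_sym hB (herm_domD Ku Kv) Kw) hermDl// rmorphD.
by rewrite (herm_sym hB Ku Kw) (herm_sym hB Kv Kw).
Qed.

Lemma hermBr u v w : K u -> K v -> K w -> B w (u - v) = B w u - B w v.
Proof.
move=> Ku Kv Kw; rewrite (herm_sym hB (herm_domB Ku Kv) Kw) hermBl// rmorphB.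
by rewrite (herm_sym hB Ku Kw) (herm_sym hB Kv Kw).
Qed.

Lemma hermZr a u w : K u -> K w -> B w (a *: u) = a^* * B w u.
Proof.
move=> Ku Kw; rewrite (herm_sym hB (herm_domZ a Ku) Kw) hermZl// rmorphM.
by rewrite (herm_sym hB Ku Kw).
Qed.

Lemma herm0r w : K w -> B w 0 = 0.
Proof.
by move=> Kw; rewrite (herm_sym hB (herm_dom0 hB) Kw) herm0l// rmorph0.
Qed.

Lemma qform0 : Q 0 = 0.
Proof. by rewrite /qform (herm0l (herm_dom0 hB)). Qed.

Lemma herm_real u : K u -> complex.Im (B u u) = 0.
Proof.
move=> Ku; have /(congr1 (@complex.Im R)) := herm_sym hB Ku Ku.
by rewrite cImJ => h; lra.
Qed.

Lemma hermE u : K u -> B u u = (Q u)%:C.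
Proof. by move=> Ku; apply: complex_eq => //=; exact: herm_real. Qed.

Lemma Re_herm_sym u v : K u -> K v -> complex.Re (B v u) = complex.Re (B u v).
Proof. by move=> Ku Kv; rewrite (herm_sym hB Ku Kv) cReJ. Qed.

(** Multiplying the second argument by [i] turns real parts into imaginary
    parts, so identities and bounds need only be proved for real parts. *)
Lemma Im_herm u v : K u -> K v ->
  complex.Im (B u v) = complex.Re (B u ('i%C *: v)).
Proof.
by move=> Ku Kv; rewrite hermZr// conj_complexE cReM/= !mul0r; ring.
Qed.

Lemma qformD u v : K u -> K v -> Q (u + v) = Q u + 2 * complex.Re (B u v) + Q v.
Proof.
move=> Ku Kv; have Kuv := herm_domD Ku Kv.
by rewrite /qform hermDl// !hermDr// !cReD (Re_herm_sym Ku Kv); ring.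
Qed.

Lemma qformZ a u : K u ->
  Q (a *: u) = (complex.Re a ^+ 2 + complex.Im a ^+ 2) * Q u.
Proof.
move=> Ku; rewrite /qform (hermZl _ Ku (herm_domZ a Ku)) hermZr// hermE//.
by rewrite !cReImE /=; ring.
Qed.

Lemma qformN u : K u -> Q (- u) = Q u.
Proof. by move=> Ku; rewrite -scaleN1r qformZ//=; ring. Qed.

Lemma qformB u v : K u -> K v -> Q (u - v) = Q u - 2 * complex.Re (B u v) + Q v.
Proof.
move=> Ku Kv; have Kuv := herm_domB Ku Kv.
by rewrite /qform hermBl// !hermBr// !cReImE (Re_herm_sym Ku Kv); ring.
Qed.

Lemma qform_distC u v : K u -> K v -> Q (u - v) = Q (v - u).
Proof. by move=> Ku Kv; rewrite -qformN ?opprB//; exact: herm_domB. Qed.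

(** The parallelogram law, in the form in which it makes minimising sequences
    Cauchy. *)
Lemma qform_half u v : K u -> K v ->
  Q ((2^-1)%:C *: (u + v)) = Q u / 2 + Q v / 2 - Q (u - v) / 4.
Proof.
move=> Ku Kv; rewrite (qformZ _ (herm_domD Ku Kv)) qformD// qformB//=.
by field.
Qed.

End HermitianForms.

Record psd_form {R : rcfType} {E : lmodType R[i]} (K : set E)
    (B : E -> E -> R[i]) : Prop := PsdForm {
  psd_herm : herm_form K B;
  psd_ge0 : forall u, K u -> 0 <= qform B u }.

Section PositiveForms.
Context {R : realType} {E : lmodType R[i]} {K : set E} {B : E -> E -> R[i]}.
Hypothesis hB : psd_form K B.
Implicit Types (u v w : E) (a : R[i]).
Let hH : herm_form K B := psd_herm hB.
Local Notation Q := (qform B).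

(** The quadratic [Q (u + t v)] in the real variable [t] stays nonnegative; since
    [Q v] may vanish, the degenerate case is excluded by a large [t]. *)
Lemma psd_cauchy_schwarz u v : K u -> K v -> complex.Re (B u v) ^+ 2 <= Q u * Q v.
Proof.
move=> Ku Kv; set r := complex.Re (B u v).
have Q0 t : 0 <= Q u + 2 * t * r + t ^+ 2 * Q v.
  have Ktv : K (t%:C *: v) by exact: (herm_domZ hH).
  have := psd_ge0 hB (herm_domD hH Ku Ktv).
  rewrite (qformD hH)// (qformZ hH)// (hermZr hH)// !cReImE/= -/r.
  by move=> /le_trans; apply; rewrite le_eqVlt; apply/orP; left; apply/eqP; ring.
have Qu := psd_ge0 hB Ku; have Qv := psd_ge0 hB Kv.
have [Qv0|Qv0] := eqVneq (Q v) 0.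
  have [->|r0] := eqVneq r 0; first by rewrite expr0n /= mulr_ge0.
  have := Q0 (- (Q u + 1) / (2 * r)).
  rewrite Qv0 mulr0 addr0.
  have -> : Q u + 2 * (- (Q u + 1) / (2 * r)) * r = -1 by field.
  by rewrite ler0N1.
have Qv1 : 0 < Q v by rewrite lt_def Qv0.
have := Q0 (- r / Q v).
have -> : Q u + 2 * (- r / Q v) * r + (- r / Q v) ^+ 2 * Q v
    = (Q u * Q v - r ^+ 2) / Q v by field.
by rewrite pmulr_lge0 ?invr_gt0// subr_ge0.
Qed.

Lemma psd_Re_le u v : K u -> K v ->
  `|complex.Re (B u v)| <= Num.sqrt (Q u) * Num.sqrt (Q v).
Proof.
move=> Ku Kv; rewrite -sqrtrM ?(psd_ge0 hB)// -sqrtr_sqr.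
by rewrite ler_wsqrtr// psd_cauchy_schwarz.
Qed.

Lemma psd_Im_le u v : K u -> K v ->
  `|complex.Im (B u v)| <= Num.sqrt (Q u) * Num.sqrt (Q v).
Proof.
move=> Ku Kv; rewrite (Im_herm hH)// (le_trans (psd_Re_le _ _))//.
  exact: (herm_domZ hH).
by rewrite (qformZ hH)//= expr0n expr1n/= add0r mul1r.
Qed.

Lemma psd_normD u v : K u -> K v ->
  Num.sqrt (Q (u + v)) <= Num.sqrt (Q u) + Num.sqrt (Q v).
Proof.
move=> Ku Kv; have Qu := psd_ge0 hB Ku; have Qv := psd_ge0 hB Kv.
rewrite -[X in _ <= X]ger0_norm ?addr_ge0 ?sqrtr_ge0// -sqrtr_sqr.
rewrite ler_wsqrtr// (qformD hH)// sqrrD !sqr_sqrtr//.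
by have := psd_Re_le Ku Kv; rewrite ler_norml => /andP[_]; lra.
Qed.

Lemma qformD_le u v : K u -> K v -> Q (u + v) <= 2 * Q u + 2 * Q v.
Proof.
move=> Ku Kv; have := psd_ge0 hB (herm_domB hH Ku Kv).
by rewrite (qformB hH)// (qformD hH)//; lra.
Qed.

Lemma qformB_le u v w : K u -> K v -> K w ->
  Q (u - w) <= 2 * Q (u - v) + 2 * Q (v - w).
Proof.
move=> Ku Kv Kw; rewrite -(subrKA v) qformD_le//; exact: (herm_domB hH).
Qed.

Section LimitsOfForms.
Context {T : Type} {F : set_system T} {FF : ProperFilter F}.
Implicit Types s t : T -> E.

Lemma psd_cvg0 s t : (forall i, K (s i)) -> (forall i, K (t i)) ->
  Num.sqrt (Q (s i)) * Num.sqrt (Q (t i)) @[i --> F] --> (0 : R) ->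
  B (s i) (t i) @[i --> F] --> (0 : R[i]^o).
Proof.
move=> Ks Kt h; apply/cvg_complexP; split.
  apply/norm_cvg0P; apply: cvg0_le h => // i; exact: psd_Re_le.
apply/norm_cvg0P; apply: cvg0_le h => // i; exact: psd_Im_le.
Qed.

(** Joint continuity, from the expansion of [B s t - B u v] in the differences
    [s - u] and [t - v] and the Cauchy-Schwarz inequality. *)
Lemma psd_cvg s t u v : K u -> K v -> (forall i, K (s i)) -> (forall i, K (t i)) ->
  Q (s i - u) @[i --> F] --> (0 : R) -> Q (t i - v) @[i --> F] --> (0 : R) ->
  B (s i) (t i) @[i --> F] --> (B u v : R[i]^o).
Proof.
move=> Ku Kv Ks Kt hs ht.
have Kd i : K (s i - u) by exact: (herm_domB hH).
have Ke i : K (t i - v) by exact: (herm_domB hH).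
have -> : (fun i => B (s i) (t i)) =
  (fun i => B (s i - u) (t i - v) + (B (s i - u) v + B u (t i - v)) + B u v).
  apply/funext => i; rewrite (hermBl hH)// !(hermBr hH)// (hermBl hH)//.
  ring.
rewrite -[X in _ --> X]add0r -[X in X + _]add0r -[X in _ + X + _]add0r.
have hs' : Num.sqrt (Q (s i - u)) @[i --> F] --> (0 : R) by exact: cvg0_sqrt.
have ht' : Num.sqrt (Q (t i - v)) @[i --> F] --> (0 : R) by exact: cvg0_sqrt.
apply: (@cvgD _ R[i]^o); last exact: cvg_cst.
apply: (@cvgD _ R[i]^o); last apply: (@cvgD _ R[i]^o).
- apply: psd_cvg0 => //.
  by rewrite -[X in _ --> X](mulr0 (0 : R)); exact: (cvgM hs' ht').
- apply: psd_cvg0 => //.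
  by rewrite -[X in _ --> X](mul0r (Num.sqrt (Q v))); exact: (cvgM hs' (cvg_cst _)).
- apply: psd_cvg0 => //.
  by rewrite -[X in _ --> X](mulr0 (Num.sqrt (Q u))); exact: (cvgM (cvg_cst _) ht').
Qed.

End LimitsOfForms.

End PositiveForms.

Section CauchyInForm.
Context {R : realType} {E : lmodType R[i]} {K : set E} {B : E -> E -> R[i]}.
Hypothesis hB : psd_form K B.
Implicit Types s t : nat -> E.
Local Notation Q := (qform B).
Let hH : herm_form K B := psd_herm hB.

Lemma psd_cauchy_bounded s : (forall n, K (s n)) ->
  Q (s p.1 - s p.2) @[p --> (\oo, \oo)] --> (0 : R) ->
  exists c : R, forall n, Num.sqrt (Q (s n)) <= c.
Proof.
move=> Ks hs; have [|l hl] := @cauchy_seq_cvg R (fun n => Num.sqrt (Q (s n))).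
  apply/norm_cvg0P; apply: cvg0_le (cvg0_sqrt hs) => p //.
  have h1 := psd_normD hB (herm_domB hH (Ks p.1) (Ks p.2)) (Ks p.2).
  have h2 := psd_normD hB (herm_domB hH (Ks p.2) (Ks p.1)) (Ks p.1).
  rewrite !subrK [Q (s p.2 - s p.1)](qform_distC hH)// in h1 h2.
  by rewrite ler_norml; apply/andP; split; lra.
have hcv : cvgn (fun n => Num.sqrt (Q (s n))) by apply/cvg_ex; exists l.
have [M [_ hM]] := cvg_seq_bounded hcv.
exists (M + 1) => n; apply: le_trans (ler_norm _) _.
by apply: (hM (M + 1) _ n I); rewrite ltrDl.
Qed.

Lemma psd_cvg0_bounded (T : Type) (F : set_system T) {FF : ProperFilter F}
    (s t : T -> E) (c : R) :
  (forall i, K (s i)) -> (forall i, K (t i)) ->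
  Q (s i) @[i --> F] --> (0 : R) -> (forall i, Num.sqrt (Q (t i)) <= c) ->
  B (s i) (t i) @[i --> F] --> (0 : R[i]^o) /\
  B (t i) (s i) @[i --> F] --> (0 : R[i]^o).
Proof.
move=> Ks Kt hs hc.
have h : Num.sqrt (Q (s i)) * Num.sqrt (Q (t i)) @[i --> F] --> (0 : R).
  apply: (@cvg0_le _ _ _ _ _ (fun i => Num.sqrt (Q (s i)) * c)).
  - by move=> i; rewrite mulr_ge0// sqrtr_ge0.
  - by move=> i; rewrite ler_wpM2l// sqrtr_ge0.
  rewrite -[X in _ --> X](mul0r c); apply: cvgM; last exact: cvg_cst.
  exact: cvg0_sqrt.
split; apply: (psd_cvg0 hB) => //.
by under eq_fun do rewrite mulrC.
Qed.

Lemma psd_cauchy_cvg s t : (forall n, K (s n)) -> (forall n, K (t n)) ->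
  Q (s p.1 - s p.2) @[p --> (\oo, \oo)] --> (0 : R) ->
  Q (t p.1 - t p.2) @[p --> (\oo, \oo)] --> (0 : R) ->
  exists z : R[i], B (s n) (t n) @[n --> \oo] --> (z : R[i]^o).
Proof.
move=> Ks Kt hs ht.
have [c hc] := psd_cauchy_bounded Ks hs; have [d hd] := psd_cauchy_bounded Kt ht.
have Kds (p : nat * nat) : K (s p.1 - s p.2) by exact: (herm_domB hH).
have Kdt (p : nat * nat) : K (t p.1 - t p.2) by exact: (herm_domB hH).
have l1 : B (s p.1 - s p.2) (t p.1) @[p --> (\oo, \oo)] --> (0 : R[i]^o).
  exact: (@psd_cvg0_bounded _ _ _ (fun p : nat * nat => s p.1 - s p.2)
    (fun p => t p.1) d Kds (fun p => Kt p.1) hs (fun p => hd p.1)).1.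
have l2 : B (s p.2) (t p.1 - t p.2) @[p --> (\oo, \oo)] --> (0 : R[i]^o).
  exact: (@psd_cvg0_bounded _ _ _ (fun p : nat * nat => t p.1 - t p.2)
    (fun p => s p.2) c Kdt (fun p => Ks p.2) ht (fun p => hc p.2)).2.
have : B (s p.1) (t p.1) - B (s p.2) (t p.2) @[p --> (\oo, \oo)] --> (0 : R[i]^o).
  have -> : (fun p : nat * nat => B (s p.1) (t p.1) - B (s p.2) (t p.2)) =
    (fun p => B (s p.1 - s p.2) (t p.1) + B (s p.2) (t p.1 - t p.2)).
    by apply/funext => p; rewrite (hermBl hH)// (hermBr hH)//; ring.
  rewrite -[X in _ --> X]add0r.
  exact: (@cvgD _ R[i]^o _ _ _
    (fun p : nat * nat => B (s p.1 - s p.2) (t p.1)) _ _ _ l1 l2).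
move=> /cvg_complexP[hR hI].
have [|a ha] := @cauchy_seq_cvg R (fun n => complex.Re (B (s n) (t n))).
  by under eq_fun do rewrite -cReN -cReD.
have [|b hb] := @cauchy_seq_cvg R (fun n => complex.Im (B (s n) (t n))).
  by under eq_fun do rewrite -cImN -cImD.
by exists (a +i* b); apply/cvg_complexP.
Qed.

End CauchyInForm.

(** * Sums over a countable set *)

Section CountableSums.
Context {R : realType} {X : countType}.
Implicit Types f g : X -> R.
Local Notation Summ f := (summable [set: X] (EFin \o f)).
Local Notation possum f := (fine (\esum_(x in [set: X]) (f x)%:E)).

Lemma summable_le f g : (forall x, `|f x| <= `|g x|) -> Summ g -> Summ f.
Proof.
by move=> fg; apply: le_lt_trans; apply: le_esum => x _ /=; rewrite lee_fin fg.
Qed.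

Lemma summable_ge0P f : (forall x, 0 <= f x) ->
  Summ f <-> (\esum_(x in [set: X]) (f x)%:E < +oo)%E.
Proof.
move=> f0; rewrite /summable (@eq_esum _ _ _ _ (fun x => (f x)%:E))// => x _ /=.
by rewrite ger0_norm.
Qed.

Lemma possum_fin f : (forall x, 0 <= f x) -> Summ f ->
  ((possum f)%:E = \esum_(x in [set: X]) (f x)%:E)%E.
Proof.
move=> f0 fs; rewrite fineK// fin_numElt (lt_le_trans (ltNyr 0))//=.
  exact/(summable_ge0P f0).
by apply: esum_ge0 => x _; rewrite lee_fin.
Qed.

Lemma summD f g : Summ f -> Summ g -> Summ (fun x => f x + g x).
Proof. by move=> fs gs; exact: (summableD fs gs). Qed.

Lemma summN f : Summ f -> Summ (fun x => - f x).
Proof. by apply: summable_le => x; rewrite normrN. Qed.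

Lemma summB f g : Summ f -> Summ g -> Summ (fun x => f x - g x).
Proof. by move=> fs gs; exact/summD/summN. Qed.

Lemma possumD f g : (forall x, 0 <= f x) -> (forall x, 0 <= g x) ->
  Summ f -> Summ g -> possum (fun x => f x + g x) = possum f + possum g.
Proof.
move=> f0 g0 fs gs; apply: EFin_inj; rewrite EFinD !possum_fin//.
- by rewrite -esumD// => x _; rewrite lee_fin.
- by move=> x; rewrite addr_ge0.
- exact: summD.
Qed.

Lemma rsum_sub f g : (forall x, 0 <= f x) -> (forall x, 0 <= g x) ->
  Summ f -> Summ g -> rsum (fun x => f x - g x) = possum f - possum g.
Proof.
move=> f0 g0 fs gs; rewrite /rsum.
have -> : EFin \o (fun x => f x - g x) = ((EFin \o f) \- (EFin \o g))%E by [].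
rewrite esumB//; [|by move=> x _; rewrite lee_fin..].
by rewrite -[X in (X - _)%E](possum_fin f0)// -[X in (_ - X)%E](possum_fin g0).
Qed.

(** Linearity of [rsum] is proved for nonnegative families, where the sum is a
    supremum of finite sums, and transported along this decomposition. *)
Lemma summ_posneg f : Summ f ->
  [/\ Summ (fun x => Num.max (f x) 0), Summ (fun x => Num.max (- f x) 0)
    & f = (fun x => Num.max (f x) 0 - Num.max (- f x) 0)].
Proof.
move=> fs; split.
- apply: summable_le fs => x; rewrite ger0_norm ?le_max ?lexx ?orbT// ge_max normr_ge0.
  by rewrite ler_norm.
- apply: summable_le fs => x; rewrite ger0_norm ?le_max ?lexx ?orbT// ge_max normr_ge0.
  by rewrite -normrN ler_norm.
- by apply/funext => x; rewrite /Num.max; case: ltP => ?; case: ltP => ?; lra.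
Qed.

Lemma rsumD f g : Summ f -> Summ g ->
  rsum (fun x => f x + g x) = rsum f + rsum g.
Proof.
move=> fs gs; have [fp fm fE] := summ_posneg fs; have [gp gm gE] := summ_posneg gs.
have p0 (h : X -> R) x : 0 <= Num.max (h x) 0 by rewrite le_max lexx orbT.
have sp := summD fp gp; have sm := summD fm gm.
have p0D (h k : X -> R) x : 0 <= Num.max (h x) 0 + Num.max (k x) 0.
  by rewrite addr_ge0.
have pN := p0 (fun x => - f x); have qN := p0 (fun x => - g x).
rewrite [in RHS]fE [in RHS]gE !rsum_sub//.
rewrite addrACA -opprD -!possumD//.
have nN := p0D (fun x => - f x) (fun x => - g x).
rewrite -(@rsum_sub (fun x => Num.max (f x) 0 + Num.max (g x) 0)
                    (fun x => Num.max (- f x) 0 + Num.max (- g x) 0))//.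
by congr rsum; apply/funext => x; rewrite {1}fE {1}gE; ring.
Qed.

Lemma rsum_ge0E f : (forall x, 0 <= f x) -> Summ f -> rsum f = possum f.
Proof.
move=> f0 fs; rewrite -[RHS]subr0.
have z0 : possum (fun _ : X => 0) = 0 :> R by rewrite esum1.
rewrite -z0 -rsum_sub//; first by congr rsum; apply/funext => x; rewrite subr0.
by apply: summable_le fs => x; rewrite normr0.
Qed.

Lemma rsum_ge0 f : (forall x, 0 <= f x) -> Summ f -> 0 <= rsum f.
Proof.
move=> f0 fs; rewrite rsum_ge0E// fine_ge0//.
by apply: esum_ge0 => x _; rewrite lee_fin.
Qed.

Lemma rsum0 : rsum (fun _ : X => 0) = 0 :> R.
Proof.
have h : Summ (fun _ : X => 0 : R).
  by rewrite /summable esum1//= => x _; rewrite normr0.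
by rewrite rsum_ge0E// esum1.
Qed.

Lemma rsumN f : Summ f -> rsum (fun x => - f x) = - rsum f.
Proof.
move=> fs; apply/eqP; rewrite -addr_eq0 -rsumD//; last exact: summN.
by apply/eqP; rewrite -[RHS]rsum0; congr rsum; apply/funext => x; rewrite addNr.
Qed.

Lemma rsumB f g : Summ f -> Summ g ->
  rsum (fun x => f x - g x) = rsum f - rsum g.
Proof. by move=> fs gs; rewrite rsumD ?rsumN//; exact: summN. Qed.

Lemma le_rsum f g : Summ f -> Summ g -> (forall x, f x <= g x) ->
  rsum f <= rsum g.
Proof.
move=> fs gs fg; rewrite -subr_ge0 -rsumB// rsum_ge0// => [x|].
  by rewrite subr_ge0.
exact: summB.
Qed.

Lemma summable_boundP f (M : R) : (forall x, 0 <= f x) ->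
  (forall r : seq X, uniq r -> \sum_(x <- r) f x <= M) ->
  Summ f /\ rsum f <= M.
Proof.
move=> f0 fM; have h : (\esum_(x in [set: X]) (f x)%:E <= M%:E)%E.
  apply: ge_ereal_sup => _ [A [finA _] <-].
  rewrite fsbig_finite//= sumEFin lee_fin fM//; exact: fset_uniq.
have fs : Summ f by apply/summable_ge0P => //; apply: le_lt_trans h (ltry _).
by split=> //; rewrite rsum_ge0E// -lee_fin possum_fin.
Qed.

Lemma le_sum_rsum f (r : seq X) : (forall x, 0 <= f x) -> Summ f -> uniq r ->
  \sum_(x <- r) f x <= rsum f.
Proof.
move=> f0 fs ur; rewrite rsum_ge0E// -lee_fin possum_fin//.
apply: esum_ge; exists [set` r]; first by split => //; exact: finite_seq.
by rewrite -fsbig_seq// sumEFin.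
Qed.

Lemma rsum_adherent f (e : R) : (forall x, 0 <= f x) -> Summ f -> 0 < e ->
  exists2 r : seq X, uniq r & rsum f - e < \sum_(x <- r) f x.
Proof.
move=> f0 fs e0; apply: contrapT => h.
have [|_] := @summable_boundP f (rsum f - e) f0; last by lra.
move=> r ur; rewrite leNgt; apply/negP => hr; apply: h; by exists r.
Qed.

Lemma rsum_finite f (r : seq X) : uniq r -> (forall x, x \notin r -> f x = 0) ->
  Summ f /\ rsum f = \sum_(x <- r) f x.
Proof.
move=> ur f0.
have nonneg (g : X -> R) : (forall x, 0 <= g x) -> (forall x, x \notin r -> g x = 0) ->
    Summ g /\ rsum g = \sum_(x <- r) g x.
  move=> g0 gr; have [|gs gle] := @summable_boundP g (\sum_(x <- r) g x) g0.
    move=> r' ur'; rewrite (bigID (mem r))/= [X in _ + X]big1 ?addr0; last first.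
      by move=> x; exact: gr.
    rewrite -big_filter [leRHS](bigID (mem r'))/= -[X in _ <= X + _]big_filter.
    rewrite (perm_big [seq x <- r | x \in r']); last first.
      apply: uniq_perm; [exact: filter_uniq|exact: filter_uniq|move=> x].
      by rewrite !mem_filter andbC.
    by rewrite lerDl sumr_ge0.
  by split=> //; apply/eqP; rewrite eq_le gle le_sum_rsum.
have p0 (h : X -> R) x : 0 <= Num.max (h x) 0 by rewrite le_max lexx orbT.
have [|fp fpE] := nonneg (fun x => Num.max (f x) 0) (p0 f).
  by move=> x /f0 ->; rewrite maxxx.
have [|fm fmE] := nonneg (fun x => Num.max (- f x) 0) (p0 (fun x => - f x)).
  by move=> x /f0 ->; rewrite oppr0 maxxx.
have fE : f = (fun x => Num.max (f x) 0 - Num.max (- f x) 0).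
  by apply/funext => x; rewrite /Num.max; case: ltP => ?; case: ltP => ?; lra.
split; first by rewrite fE; exact: summB.
rewrite {1}fE rsumB// fpE fmE -sumrB; apply: eq_bigr => x _.
by rewrite /Num.max; case: ltP => ?; case: ltP => ?; lra.
Qed.

Lemma summZ (a : R) f : Summ f -> Summ (fun x => a * f x).
Proof.
move=> fs.
have [|h _] := @summable_boundP (fun x => `|a * f x|) (`|a| * rsum (fun x => `|f x|))
  (fun x => normr_ge0 _).
  move=> r ur; under eq_bigr do rewrite normrM.
  rewrite -mulr_sumr ler_wpM2l// le_sum_rsum//.
  by apply: summable_le fs => x; rewrite normr_id.
by apply: summable_le h => x; rewrite normr_id.
Qed.

Lemma rsumZ (a : R) f : Summ f -> rsum (fun x => a * f x) = a * rsum f.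
Proof.
have nonneg (b : R) (g : X -> R) : 0 <= b -> (forall x, 0 <= g x) -> Summ g ->
    rsum (fun x => b * g x) = b * rsum g.
  move=> b0 g0 gs; have bg0 x : 0 <= b * g x by rewrite mulr_ge0.
  apply/eqP; rewrite eq_le; apply/andP; split.
    apply: (summable_boundP bg0 _).2 => r ur.
    by rewrite -mulr_sumr ler_wpM2l// le_sum_rsum.
  have [b00|bN0] := eqVneq b 0.
    rewrite b00 mul0r rsum_ge0// => [x|]; first by rewrite mul0r.
    exact: summZ.
  have b0' : 0 < b by rewrite lt_def bN0.
  rewrite -(ler_pdivlMl _ _ b0'); apply: (summable_boundP g0 _).2 => r ur.
  rewrite (ler_pdivlMl _ _ b0') mulr_sumr le_sum_rsum//; exact: summZ.
have pos (b : R) (g : X -> R) : 0 <= b -> Summ g ->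
    rsum (fun x => b * g x) = b * rsum g.
  move=> b0 gs; have [gp gm gE] := summ_posneg gs.
  have p0 (h : X -> R) x : 0 <= Num.max (h x) 0 by rewrite le_max lexx orbT.
  rewrite [in RHS]gE rsumB// mulrBr -!nonneg//.
  - rewrite -rsumB; [|exact: summZ..].
    by congr rsum; apply/funext => x; rewrite {1}gE; ring.
  - exact: p0 (fun x => - g x).
move=> fs; have [a0|a0] := leP 0 a; first exact: pos.
rewrite -[a]opprK mulNr -pos ?oppr_ge0 ?(ltW a0)// -rsumN; last exact: summZ.
by congr rsum; apply/funext => x; ring.
Qed.

End CountableSums.

Section ComplexSums.
Context {R : realType} {X : countType}.
Implicit Types f g : X -> R[i].

(** The families on which [csum] is linear. *)
Definition csummable f : Prop :=
  summable [set: X] (EFin \o (fun x => complex.Re (f x))) /\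
  summable [set: X] (EFin \o (fun x => complex.Im (f x))).

Lemma csumD f g : csummable f -> csummable g ->
  csum (fun x => f x + g x) = csum f + csum g.
Proof.
move=> [fR fI] [gR gI]; apply: complex_eq.
  by rewrite cReD /= -rsumD//; congr rsum; apply/funext => x; rewrite cReD.
by rewrite cImD /= -rsumD//; congr rsum; apply/funext => x; rewrite cImD.
Qed.

Lemma csumZ (a : R[i]) f : csummable f -> csum (fun x => a * f x) = a * csum f.
Proof.
move=> [fR fI]; apply: complex_eq.
  rewrite cReM /= -!rsumZ// -rsumB; [|exact: summZ..].
  by congr rsum; apply/funext => x; rewrite cReM.
rewrite cImM /= -!rsumZ// -rsumD; [|exact: summZ..].
by congr rsum; apply/funext => x; rewrite cImM.
Qed.

Lemma csumJ f : csummable f -> csum (fun x => (f x)^*) = (csum f)^*.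
Proof.
move=> [fR fI]; apply: complex_eq.
  by rewrite cReJ /=; congr rsum; apply/funext => x; rewrite cReJ.
by rewrite cImJ /= -rsumN//; congr rsum; apply/funext => x; rewrite cImJ.
Qed.

Lemma csum_finite f (r : seq X) : uniq r -> (forall x, x \notin r -> f x = 0) ->
  csum f = \sum_(x <- r) f x.
Proof.
move=> ur f0; apply: complex_eq => /=.
  have [|_ ->] := @rsum_finite _ _ (fun x => complex.Re (f x)) r ur.
    by move=> x /f0 ->.
  by rewrite (big_morph _ cReD (erefl : complex.Re (0 : R[i]) = 0)).
have [|_ ->] := @rsum_finite _ _ (fun x => complex.Im (f x)) r ur.
  by move=> x /f0 ->.
by rewrite (big_morph _ cImD (erefl : complex.Im (0 : R[i]) = 0)).
Qed.

End ComplexSums.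

(** * Weighted square-summable functions *)

Section WeightedEll2.
Context {R : realType} {X : countType} {w : X -> R}.
Hypothesis w0 : forall x, 0 <= w x.
Implicit Types f g u v : X -> R[i].
Local Notation Q := (qform (inner w)).
Local Notation wsq f :=
  (fun x => w x * (complex.Re (f x) ^+ 2 + complex.Im (f x) ^+ 2)).

Lemma wsq_ge0 f x : 0 <= wsq f x.
Proof. by rewrite mulr_ge0// addr_ge0// sqr_ge0. Qed.

Lemma ell2E f : ell2 w f = summable [set: X] (EFin \o wsq f).
Proof.
rewrite /ell2 /=; congr (is_true (summable _ _)).
by apply/funext => x /=; rewrite sqr_normcE.
Qed.

Lemma qform_inner f : Q f = rsum (wsq f).
Proof.
rewrite /qform /inner /csum /=; congr rsum; apply/funext => x.
by rewrite !cReImE /=; ring.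
Qed.

Lemma ell2_normE f : ell2_norm w f = Num.sqrt (Q f).
Proof.
rewrite /ell2_norm qform_inner; congr (Num.sqrt (rsum _)).
by apply/funext => x; rewrite sqr_normcE.
Qed.

Lemma ell2_lin (a : R[i]) u v : ell2 w u -> ell2 w v -> ell2 w (a *: u + v).
Proof.
rewrite !ell2E => us vs.
apply: (summable_le _ (summD (summZ (2 * (complex.Re a ^+ 2 + complex.Im a ^+ 2)) us)
                            (summZ 2 vs))) => x.
rewrite !ger0_norm ?addr_ge0 ?wsq_ge0//; last 2 first.
- by rewrite !mulr_ge0// ?wsq_ge0// ?addr_ge0// ?sqr_ge0.
- by rewrite !mulr_ge0// ?wsq_ge0// ?addr_ge0// ?sqr_ge0.
rewrite [X in _ <= X](_ : _ = w x *
  (2 * (complex.Re a ^+ 2 + complex.Im a ^+ 2) *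
   (complex.Re (u x) ^+ 2 + complex.Im (u x) ^+ 2) +
   2 * (complex.Re (v x) ^+ 2 + complex.Im (v x) ^+ 2))); last by ring.
rewrite ler_wpM2l//.
have -> : (a *: u + v) x = a * u x + v x by [].
rewrite !cReImE.
set p := _ - _; set q := complex.Re a * _ + _.
have -> : 2 * (complex.Re a ^+ 2 + complex.Im a ^+ 2) *
  (complex.Re (u x) ^+ 2 + complex.Im (u x) ^+ 2) = 2 * (p ^+ 2 + q ^+ 2).
  by rewrite /p /q; ring.
have := sqr_ge0 (p - complex.Re (v x)).
have := sqr_ge0 (q - complex.Im (v x)).
nra.
Qed.

Lemma ell2_0 : ell2 w 0.
Proof.
rewrite ell2E; apply: (@rsum_finite R X _ [::] isT _).1 => x _.
by rewrite expr0n /= addr0 mulr0.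
Qed.

Lemma inner_summable u v : ell2 w u -> ell2 w v ->
  csummable (fun x => (w x)%:C * u x * (v x)^*).
Proof.
rewrite !ell2E => us vs; have uv := summD us vs; split.
  apply: summable_le uv => x; rewrite [X in _ <= X]ger0_norm ?addr_ge0 ?wsq_ge0//.
  rewrite !cReImE /= -mulrDr.
  have -> : (w x * complex.Re (u x) - 0 * complex.Im (u x)) * complex.Re (v x) -
    (w x * complex.Im (u x) + 0 * complex.Re (u x)) * - complex.Im (v x)
    = w x * (complex.Re (u x) * complex.Re (v x) + complex.Im (u x) * complex.Im (v x)).
    by ring.
  rewrite normrM ger0_norm// ler_wpM2l//.
  have := sqr_ge0 (complex.Re (u x) + complex.Re (v x)).
  have := sqr_ge0 (complex.Re (u x) - complex.Re (v x)).
  have := sqr_ge0 (complex.Im (u x) + complex.Im (v x)).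
  have := sqr_ge0 (complex.Im (u x) - complex.Im (v x)).
  by move=> h1 h2 h3 h4; rewrite ler_norml; apply/andP; split; nra.
apply: summable_le uv => x; rewrite [X in _ <= X]ger0_norm ?addr_ge0 ?wsq_ge0//.
rewrite !cReImE /= -mulrDr.
have -> : (w x * complex.Re (u x) - 0 * complex.Im (u x)) * - complex.Im (v x) +
    (w x * complex.Im (u x) + 0 * complex.Re (u x)) * complex.Re (v x)
    = w x * (complex.Im (u x) * complex.Re (v x) - complex.Re (u x) * complex.Im (v x)).
  by ring.
rewrite normrM ger0_norm// ler_wpM2l//.
have := sqr_ge0 (complex.Re (u x) + complex.Im (v x)).
have := sqr_ge0 (complex.Re (u x) - complex.Im (v x)).
have := sqr_ge0 (complex.Im (u x) + complex.Re (v x)).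
have := sqr_ge0 (complex.Im (u x) - complex.Re (v x)).
by move=> h1 h2 h3 h4; rewrite ler_norml; apply/andP; split; nra.
Qed.

Lemma inner_psd : psd_form (ell2 w) (inner w : (X -> R[i]) -> (X -> R[i]) -> R[i]).
Proof.
split; first split.
- exact: ell2_0.
- exact: ell2_lin.
- move=> a u v z uE vE zE; rewrite /inner -csumZ; last exact: inner_summable.
  rewrite -csumD; [|split|exact: inner_summable].
  + congr csum; apply/funext => x.
    by rewrite [(_ *: _ + _) x](_ : _ = a * u x + v x)//; ring.
  + under eq_fun do rewrite cReM.
    by case: (inner_summable uE zE) => h1 h2; apply: summB; exact: summZ.
  + under eq_fun do rewrite cImM.
    by case: (inner_summable uE zE) => h1 h2; apply: summD; exact: summZ.
- move=> u v uE vE; rewrite /inner -csumJ; last exact: inner_summable.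
  congr csum; apply/funext => x; apply: complex_eq; rewrite !cReImE /=; ring.
- move=> u; rewrite ell2E => uE; rewrite qform_inner rsum_ge0// => x.
  exact: wsq_ge0.
Qed.

Lemma ell2_normX u : ell2 w u -> ell2_norm w u ^+ 2 = Q u.
Proof. by move=> uE; rewrite ell2_normE sqr_sqrtr// (psd_ge0 inner_psd). Qed.

Lemma ell2_point u x : ell2 w u -> wsq u x <= Q u.
Proof.
rewrite ell2E => uE; rewrite qform_inner.
have := @le_sum_rsum _ _ _ [:: x] (wsq_ge0 u) uE.
by rewrite big_seq1; apply.
Qed.

Lemma CcP u : Cc u <-> exists2 r : seq X, uniq r & forall x, x \notin r -> u x = 0.
Proof.
split=> [/finite_fsetP[F hF]|[r _ ur]].
  exists F; first exact: fset_uniq.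
  move=> x; apply: contraNeq => ux.
  by have : [set x | u x != 0] x by []; rewrite hF.
apply: (@sub_finite_set _ _ [set` r]); last exact: finite_seq.
move=> x /= ux; apply: contraT => /ur ux0; by rewrite ux0 eqxx in ux.
Qed.

Lemma Cc_ell2 : @Cc R X `<=` ell2 w.
Proof.
move=> u /CcP[r rU ur]; rewrite ell2E.
apply: (@rsum_finite R X _ r rU _).1 => x /ur ->.
by rewrite expr0n /= addr0 mulr0.
Qed.

End WeightedEll2.

Section Ell2Limits.
Context {R : realType} {X : countType} {w : X -> R}.
Hypothesis w0 : forall x, 0 <= w x.
Implicit Types (f u v : X -> R[i]) (s : nat -> X -> R[i]).
Local Notation Q := (qform (inner w)).
Let psd := inner_psd w0.
Let hrm := psd_herm psd.

Lemma cvg_sum_seq (T : Type) (r : seq X) (F : set_system T) {FF : Filter F}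
    (a : X -> T -> R) (l : X -> R) :
  (forall x, a x t @[t --> F] --> l x) ->
  \sum_(x <- r) a x t @[t --> F] --> \sum_(x <- r) l x.
Proof.
move=> h; elim: r => [|x r IH].
  by rewrite big_nil; under eq_fun do rewrite big_nil; exact: cvg_cst.
by rewrite big_cons; under eq_fun do rewrite big_cons; exact: cvgD.
Qed.

(** Fatou's lemma: each finite partial sum passes to the limit, and the full sum
    is the supremum of these. *)
Lemma ell2_fatou s u (M : R) :
  (forall x, s n x @[n --> \oo] --> (u x : R[i]^o)) ->
  (\forall n \near \oo, ell2 w (s n) /\ Q (s n) <= M) ->
  ell2 w u /\ Q u <= M.
Proof.
move=> su sM; rewrite ell2E qform_inner; apply: summable_boundP.
  exact: wsq_ge0.
move=> r rU.
pose a x n := w x * (complex.Re (s n x) ^+ 2 + complex.Im (s n x) ^+ 2).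
have ha x : a x n @[n --> \oo] -->
    w x * (complex.Re (u x) ^+ 2 + complex.Im (u x) ^+ 2).
  have /cvg_complexP[hR hI] := su x.
  apply: cvgM; first exact: cvg_cst.
  by apply: cvgD; apply: cvgM.
apply: (cvgr_to_le (cvg_sum_seq (r := r) ha)).
apply: filterS sM => n [sE]; apply: le_trans.
rewrite qform_inner le_sum_rsum//; first exact: wsq_ge0.
by move: sE; rewrite ell2E.
Qed.

(** Fatou's lemma in the second index of [s n - s m] upgrades pointwise
    convergence of a Cauchy sequence to convergence in norm. The weight may
    vanish somewhere, so pointwise convergence has to be assumed. *)
Lemma ell2_closed s u : (forall n, ell2 w (s n)) ->
  (forall x, s n x @[n --> \oo] --> (u x : R[i]^o)) ->
  Q (s p.1 - s p.2) @[p --> (\oo, \oo)] --> (0 : R) ->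
  ell2 w u /\ Q (s n - u) @[n --> \oo] --> (0 : R).
Proof.
move=> sE su /cvg0_seq2P hQ.
have key e : 0 < e -> exists N, forall n, (N <= n)%N ->
    ell2 w (s n - u) /\ Q (s n - u) <= e.
  move=> e0; have [N hN] := hQ e e0; exists N => n Nn.
  apply: (@ell2_fatou (fun m => s n - s m)).
    move=> x; apply: (@cvgB _ R[i]^o); [exact: cvg_cst|exact: su].
  exists N => // m /= Nm; split; first exact: (herm_domB hrm).
  by apply: ltW; apply: le_lt_trans (hN n m Nn Nm); exact: ler_norm.
have [N hN] := key 1 ltr01.
have uE : ell2 w u.
  rewrite -(subKr (s N) u); apply: (herm_domB hrm) => //.
  exact: (hN N (leqnn N)).1.
split=> //; apply/cvg0_seqP => e e0.
have [N' hN'] := key (e / 2) (divr_gt0 e0 (ltr0Sn _ 1)).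
exists N' => n Nn; have [dE dle] := hN' n Nn.
rewrite ger0_norm ?(psd_ge0 psd)//; apply: le_lt_trans dle _; lra.
Qed.

Lemma inner_finite u v (r : seq X) : uniq r -> (forall x, x \notin r -> v x = 0) ->
  inner w u v = \sum_(x <- r) (w x)%:C * u x * (v x)^*.
Proof. by move=> rU vr; apply: csum_finite => // x /vr ->; rewrite rmorph0 mulr0. Qed.

Lemma inner_delta u (x : X) :
  inner w u (fun y => if y == x then 1 else 0) = (w x)%:C * u x.
Proof.
rewrite (@inner_finite _ _ [:: x])// => [|y].
  by rewrite big_seq1 eqxx rmorph1 mulr1.
by rewrite inE => /negbTE ->.
Qed.

(** Truncate to a finite set carrying all but [e] of the sum. *)
Lemma Cc_dense u (e : R) : ell2 w u -> 0 < e -> exists2 v, Cc v & Q (u - v) < e.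
Proof.
move=> uE e0; have := uE; rewrite ell2E => uS.
have [r rU hr] := rsum_adherent (wsq_ge0 w0 u) uS e0.
exists (fun x => if x \in r then u x else 0).
  by apply/CcP; exists r => // x /negbTE ->.
rewrite qform_inner.
pose sq (z : R[i]) := complex.Re z ^+ 2 + complex.Im z ^+ 2.
pose t x := if x \in r then w x * sq (u x) else 0.
have [|tS tE] := @rsum_finite R X t r rU.
  by move=> x /negbTE xr; rewrite /t xr.
rewrite (_ : (fun x => _) = (fun x => w x * sq (u x) - t x)); last first.
  apply/funext => x; rewrite /t.
  have -> : (u - (fun x => if x \in r then u x else 0)) x =
    u x - (if x \in r then u x else 0) by [].
  case: ifP => _; last by rewrite !subr0.
  by rewrite !subrr /= expr0n /= addr0 mulr0.
rewrite rsumB// tE (_ : \sum_(x <- r) t x = \sum_(x <- r) w x * sq (u x)).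
  by move: hr; rewrite /sq; lra.
by apply: eq_big_seq => x xr; rewrite /t xr.
Qed.

Lemma Cc_lin (a : R[i]) u v : Cc u -> Cc v -> Cc (a *: u + v).
Proof.
move=> uF vF; apply: (@sub_finite_set _ _ ([set x | u x != 0] `|` [set x | v x != 0])).
  move=> x /=; have -> : (a *: u + v) x = a * u x + v x by [].
  apply: contra_neqP => /not_orP[/negP/negPn/eqP -> /negP/negPn/eqP ->].
  by rewrite mulr0 addr0.
by rewrite finite_setU.
Qed.

Lemma Cc_delta (x : X) : @Cc R X (fun y => if y == x then 1 else 0).
Proof. by apply/CcP; exists [:: x] => // y; rewrite inE => /negbTE ->. Qed.

End Ell2Limits.

Section Ell2Complete.
Context {R : realType} {X : countType} {mu : X -> R}.
Hypothesis mu0 : forall x, 0 < mu x.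
Implicit Types (f u v : X -> R[i]) (s : nat -> X -> R[i]).
Local Notation Q := (qform (inner mu)).
Let mu0' x : 0 <= mu x := ltW (mu0 x).

Lemma ell2_cvg_point (T : Type) (F : set_system T) {FF : Filter F}
    (d : T -> X -> R[i]) (x : X) :
  (forall t, ell2 mu (d t)) -> Q (d t) @[t --> F] --> (0 : R) ->
  d t x @[t --> F] --> (0 : R[i]^o).
Proof.
move=> dE hQ.
have h : Num.sqrt ((mu x)^-1 * Q (d t)) @[t --> F] --> (0 : R).
  apply: cvg0_sqrt; rewrite -[X in _ --> X](mulr0 (mu x)^-1).
  by apply: cvgM => //; exact: cvg_cst.
have hle t : complex.Re (d t x) ^+ 2 + complex.Im (d t x) ^+ 2 <= (mu x)^-1 * Q (d t).
  by rewrite ler_pdivlMl//; exact: (ell2_point mu0').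
apply/cvg_complexP; split; apply/norm_cvg0P; apply: cvg0_le h => // t;
  rewrite -sqrtr_sqr ler_wsqrtr// (le_trans _ (hle t))//.
  by rewrite lerDl sqr_ge0.
by rewrite lerDr sqr_ge0.
Qed.

(** For a positive weight norm convergence controls every value, so a Cauchy
    sequence has a pointwise limit to which [ell2_closed] applies. *)
Lemma ell2_complete s : (forall n, ell2 mu (s n)) ->
  Q (s p.1 - s p.2) @[p --> (\oo, \oo)] --> (0 : R) ->
  exists2 u, ell2 mu u & Q (s n - u) @[n --> \oo] --> (0 : R).
Proof.
move=> sE hQ; have hrm := psd_herm (inner_psd mu0').
have lim x : exists z : R[i], s n x @[n --> \oo] --> (z : R[i]^o).
  have h : (s p.1 - s p.2) x @[p --> (\oo, \oo)] --> (0 : R[i]^o).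
    apply: (@ell2_cvg_point _ _ _ (fun p : nat * nat => s p.1 - s p.2)) => // p.
    exact: (herm_domB hrm).
  move/cvg_complexP : h => [hR hI].
  have [|a ha] := @cauchy_seq_cvg R (fun n => complex.Re (s n x)).
    by under eq_fun do rewrite -cReN -cReD.
  have [|b hb] := @cauchy_seq_cvg R (fun n => complex.Im (s n x)).
    by under eq_fun do rewrite -cImN -cImD.
  by exists (a +i* b); apply/cvg_complexP.
have [u hu] := choice lim.
have [uE uc] := ell2_closed mu0' sE hu hQ.
by exists u.
Qed.

End Ell2Complete.

(** * Semibounded forms *)

Section NearMinimisers.
Context {R : realType} {E : Type}.

(** The variational argument behind the existence results below. When [J] obeys the
    parallelogram law with defect [D], the midpoint of two near-minimisers cannot
    lie much below the infimum, which forces [D] to be small. The sets [C n] may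
    shrink as long as the infima of [J] over them stay bounded: being monotone,
    the infima then converge. *)
Lemma near_minimisers (C : nat -> set E) (J : E -> R) (mid : E -> E -> E)
    (D : E -> E -> R) (L M : R) :
  (forall n m, (n <= m)%N -> C m `<=` C n) ->
  (forall n u v, C n u -> C n v -> C n (mid u v)) ->
  (forall u v, C 0%N u -> C 0%N v ->
    [/\ 0 <= D u v, D u v = D v u & J (mid u v) = J u / 2 + J v / 2 - D u v / 4]) ->
  (forall u, C 0%N u -> L <= J u) ->
  (forall n, exists2 v, C n v & J v <= M) ->
  exists s : nat -> E, [/\ forall n, C n (s n),
    forall n v, C n v -> J (s n) <= J v + n.+1%:R^-1
    & D (s p.1) (s p.2) @[p --> (\oo, \oo)] --> (0 : R)].
Proof.
move=> Cdec Cmid HD HL HM.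
have C0 n : C n `<=` C 0%N by exact: Cdec.
pose d n := inf (J @` C n).
have lbd n : lbound (J @` C n) L by move=> _ [v /C0 Cv <-]; exact: HL.
have hinf n : has_inf (J @` C n).
  split; last by exists L.
  by have [v Cv _] := HM n; exists (J v); exists v.
have dle n v : C n v -> d n <= J v.
  by move=> Cv; apply: ge_inf; [exists L|exists v].
have Hs n : exists v, C n v /\ J v < d n + n.+1%:R^-1.
  have e0 : 0 < n.+1%:R^-1 :> R by rewrite invr_gt0.
  by have [_ [v Cv <-] hv] := inf_adherent e0 (hinf n); exists v.
have [s hs] := choice Hs.
have sC n : C n (s n) := (hs n).1.
have dmono n m : (n <= m)%N -> d n <= d m.
  move=> nm; apply: lb_le_inf; first by case: (hinf m).
  by move=> _ [v Cv <-]; apply: dle; exact: Cdec Cv.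
have dM n : d n <= M by have [v Cv] := HM n; apply: le_trans; exact: dle.
have dcvg : cvgn d.
  apply: nondecreasing_is_cvgn; first by move=> n m; exact: dmono.
  by exists M => _ [n _ <-].
clearbody d; exists s; split=> // [n v Cv|].
  by have [_ /ltW /le_trans] := hs n; apply; rewrite lerD2r dle.
have key n m : (n <= m)%N ->
    D (s n) (s m) <= 2 * (d m - d n) + 4 * n.+1%:R^-1.
  move=> nm; have [_ _ hmid] := HD _ _ (C0 _ _ (sC n)) (C0 _ _ (sC m)).
  have := dle n _ (Cmid n _ _ (sC n) (Cdec _ _ nm _ (sC m))).
  rewrite hmid; have [_ h1] := hs n; have [_ h2] := hs m.
  have : m.+1%:R^-1 <= n.+1%:R^-1 :> R by rewrite lef_pV2 ?posrE// ler_nat ltnS.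
  by move: (n.+1%:R^-1) (m.+1%:R^-1) h1 h2 => a b h1 h2; lra.
apply/cvg0_seq2P => e e0.
have [N1 hN1] : exists N, forall n, (N <= n)%N -> `|limn d - d n| < e / 12.
  have /cvgrPdist_lt h := dcvg.
  by have [N _ hN] := h (e / 12) (divr_gt0 e0 (ltr0Sn _ _)); exists N.
have [N2 hN2] : exists N, forall n, (N <= n)%N -> n.+1%:R^-1 < e / 12.
  have /cvgrPdist_lt h := @cvg_harmonic R.
  have [N _ hN] := h (e / 12) (divr_gt0 e0 (ltr0Sn _ _)); exists N => n Nn.
  by have := hN n Nn; rewrite /= sub0r normrN ger0_norm.
have bound n m : (N1 <= n)%N -> (N2 <= n)%N -> (n <= m)%N -> D (s n) (s m) < e.
  move=> n1 n2 nm; have := key n m nm.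
  have := hN1 n n1; have := hN1 m (leq_trans n1 nm); have := hN2 n n2.
  rewrite !ltr_norml; move: (n.+1%:R^-1) (limn d) => r l.
  by move=> h1 /andP[h2 h3] /andP[h4 h5] h6; lra.
exists (maxn N1 N2) => n m; rewrite !geq_max => /andP[n1 n2] /andP[m1 m2] /=.
have [D0 Dsym _] := HD _ _ (C0 _ _ (sC n)) (C0 _ _ (sC m)).
rewrite ger0_norm//; have [nm|mn] := leqP n m; first exact: bound.
by rewrite Dsym bound// ltnW.
Qed.

End NearMinimisers.

(** What closed forms share with forms on a mere core: the axioms of [closed_form]
    except density and closedness. *)
Record semibounded_form {R : realType} {X : countType} (mu : X -> R)
    (q : sform R X) : Prop := SemiboundedForm {
  sb_ell2 : fdom q `<=` ell2 mu;
  sb_herm : herm_form (fdom q) (fval q : (X -> R[i]) -> (X -> R[i]) -> R[i]);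
  sb_bounded : exists c : R, forall u, fdom q u ->
    c * qform (inner mu) u <= qform (fval q) u }.

(** The form of the operator [A + a], where [A] is the operator of [q]. *)
Definition shift {R : realType} {X : countType} (mu : X -> R) (q : sform R X)
    (a : R) (u v : X -> R[i]) : R[i] :=
  fval q u v + a%:C * inner mu u v.

(** For such [a] the form norm of [shift mu q a] dominates the norm of l^2. *)
Definition coercive {R : realType} {X : countType} (mu : X -> R) (q : sform R X)
    (a : R) : Prop :=
  forall u, fdom q u -> qform (inner mu) u <= qform (shift mu q a) u.

Section Semibounded.
Context {R : realType} {X : countType} {mu : X -> R}.
Hypothesis mu0 : forall x, 0 < mu x.
Implicit Types (q : sform R X) (u v f : X -> R[i]) (s t : nat -> X -> R[i]).
Let mu0' x : 0 <= mu x := ltW (mu0 x).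
Local Notation N := (qform (inner mu)).
Let psdN := inner_psd mu0'.
Let hrmN := psd_herm psdN.

Lemma closed_semibounded q : closed_form mu q -> semibounded_form mu q.
Proof.
case=> qE q0 qP qlin qherm [c hc] _ _; split=> //.
exists c => u qu; have := hc u qu.
by rewrite (ell2_normX mu0') ?lecE => [/andP[]//|]; exact: qE.
Qed.

Lemma qform_shift q a u : qform (shift mu q a) u = qform (fval q) u + a * N u.
Proof. by rewrite /qform /shift cReD cReM /= mul0r subr0. Qed.

Lemma semibounded_coercive q : semibounded_form mu q ->
  exists a0, forall a, a0 <= a -> coercive mu q a.
Proof.
move=> [qE _ [c hc]]; exists (1 - c) => a ha u qu; rewrite qform_shift.
have := hc u qu; have := psd_ge0 psdN (qE _ qu); nra.
Qed.

Lemma shift_psd q a : semibounded_form mu q -> coercive mu q a ->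
  psd_form (fdom q) (shift mu q a : (X -> R[i]) -> (X -> R[i]) -> R[i]).
Proof.
move=> [qE [q0 qP qlin qherm] _] qa; split; first split=> //.
- move=> b u v w qu qv qw; rewrite /shift (qlin _ _ _ _ qu qv qw).
  rewrite (herm_linear hrmN b (qE _ qu) (qE _ qv) (qE _ qw)); ring.
- move=> u v qu qv; rewrite /shift (qherm _ _ qu qv).
  rewrite (herm_sym hrmN (qE _ qu) (qE _ qv)).
  by apply: complex_eq; rewrite !cReImE /=; ring.
- move=> u qu; apply: le_trans (qa _ qu); exact: (psd_ge0 psdN (qE _ qu)).
Qed.

Lemma cvg_ell2_norm (d : nat -> X -> R[i]) : (forall n, ell2 mu (d n)) ->
  ell2_norm mu (d n) @[n --> \oo] --> (0 : R) <-> N (d n) @[n --> \oo] --> (0 : R).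
Proof.
move=> dE; split=> h.
  by under eq_fun do rewrite -(ell2_normX mu0')//; exact: cvg0_sqr.
by under eq_fun do rewrite ell2_normE; exact: cvg0_sqrt.
Qed.

Lemma cvg_cauchyN s u : ell2 mu u -> (forall n, ell2 mu (s n)) ->
  N (s n - u) @[n --> \oo] --> (0 : R) ->
  N (s p.1 - s p.2) @[p --> (\oo, \oo)] --> (0 : R).
Proof.
move=> uE sE h.
apply: (@cvg0_le _ _ _ _ _ (fun p => 2 * N (s p.1 - u) + 2 * N (s p.2 - u))).
- by move=> p; apply: (psd_ge0 psdN); exact: (herm_domB hrmN).
- move=> p; apply: le_trans (qformB_le psdN (sE p.1) uE (sE p.2)) _.
  by rewrite [X in _ + 2 * X](qform_distC hrmN uE (sE p.2)).
rewrite -[X in _ --> X](addr0 (0 : R)) -[X in _ --> X + _](mulr0 (2 : R)).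
rewrite -[X in _ --> _ + X](mulr0 (2 : R)).
apply: cvgD; apply: cvgM; try exact: cvg_cst.
  exact: (cvg_comp _ _ cvg_fst h).
exact: (cvg_comp _ _ cvg_snd h).
Qed.

(** Convergence in the form sense, restated with the inner product
    [shift mu q a], to which Hilbert space arguments apply. *)
Lemma form_cvgE q a s u : semibounded_form mu q -> coercive mu q a ->
  form_cvg mu q s u <->
  [/\ ell2 mu u, forall n, fdom q (s n), N (s n - u) @[n --> \oo] --> (0 : R)
    & qform (shift mu q a) (s p.1 - s p.2) @[p --> (\oo, \oo)] --> (0 : R)].
Proof.
move=> qsb qa; have [qE qh _] := qsb.
split=> [[uE sq su qc]|[uE sq su qc]]; split=> //.
- apply/cvg_ell2_norm => // n; apply: (herm_domB hrmN) => //; exact: qE.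
- have sE n : ell2 mu (s n) by exact: qE.
  have sdE n : ell2 mu (s n - u) by exact: (herm_domB hrmN).
  have hN := cvg_cauchyN uE sE ((cvg_ell2_norm sdE).1 su).
  have -> : (fun p : nat * nat => qform (shift mu q a) (s p.1 - s p.2)) =
    (fun p => qform (fval q) (s p.1 - s p.2) + a * N (s p.1 - s p.2)).
    by apply/funext => p; rewrite qform_shift.
  rewrite -[X in _ --> X](addr0 (0 : R)) -[X in _ --> _ + X](mulr0 a).
  apply: cvgD; last by apply: cvgM => //; exact: cvg_cst.
  by move/cvg_complexP : qc => [].
- by apply/cvg_ell2_norm => // n; apply: (herm_domB hrmN) => //; exact: qE.
- have sE n : ell2 mu (s n) by exact: qE.
  have hN := cvg_cauchyN uE sE su.
  apply/cvg0_complex_realP.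
    by move=> p; apply: (herm_real qh); exact: (herm_domB qh).
  have -> : (fun p => complex.Re (fval q (s p.1 - s p.2) (s p.1 - s p.2))) =
    (fun p : nat * nat => qform (shift mu q a) (s p.1 - s p.2) - a * N (s p.1 - s p.2)).
    by apply/funext => p; rewrite qform_shift addrK.
  rewrite -[X in _ --> X](subr0 (0 : R)) -[X in _ --> _ - X](mulr0 a).
  by apply: cvgB => //; apply: cvgM => //; exact: cvg_cst.
Qed.

Lemma closed_cvg q a s u : closed_form mu q -> coercive mu q a ->
  form_cvg mu q s u ->
  fdom q u /\ qform (shift mu q a) (s n - u) @[n --> \oo] --> (0 : R).
Proof.
move=> qc qa su; have qsb := closed_semibounded qc; have [qE qh _] := qsb.
have [qu /cvg_complexP[hR _]] := cf_closed qc su; split=> //.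
have [uE sq hN _] := (form_cvgE s u qsb qa).1 su.
have -> : (fun n => qform (shift mu q a) (s n - u)) =
  (fun n => qform (fval q) (s n - u) + a * N (s n - u)).
  by apply/funext => n; rewrite qform_shift.
rewrite -[X in _ --> X](addr0 (0 : R)) -[X in _ --> _ + X](mulr0 a).
by apply: cvgD => //; apply: cvgM => //; exact: cvg_cst.
Qed.

(** The substitute for weak compactness: l^2-approximation with bounded energy
    already gives convergence in the form sense along another sequence. Choosing
    near-minimisers of the energy on the shrinking balls around [u], whose
    intersections with the domain are convex, makes the sequence Cauchy for the
    energy. *)
Lemma bounded_energy_form_cvg q a u (M : R) :
  semibounded_form mu q -> coercive mu q a -> ell2 mu u ->
  (forall e, 0 < e -> exists v, [/\ fdom q v, N (v - u) <= e
    & qform (shift mu q a) v <= M]) ->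
  exists s, form_cvg mu q s u.
Proof.
move=> qsb qa uE hM; have [qE qh _] := qsb.
have psdQ := shift_psd qsb qa; have hrmQ := psd_herm psdQ.
pose C (n : nat) := [set v | fdom q v /\ N (v - u) <= n.+1%:R^-1].
pose mid u v : X -> R[i] := (2^-1)%:C *: (u + v).
have [||||n|s [sC _ hs]] := @near_minimisers R _ C (qform (shift mu q a)) mid
  (fun u v => qform (shift mu q a) (u - v)) 0 M.
- move=> n m nm v [qv vu]; split=> //; apply: le_trans vu _.
  by rewrite lef_pV2 ?posrE// ler_nat ltnS.
- move=> n v v' [qv vu] [qv' vu']; split.
    by apply: (herm_domZ qh); exact: (herm_domD qh).
  have vE : ell2 mu (v - u) by apply: (herm_domB hrmN) => //; exact: qE.
  have vE' : ell2 mu (v' - u) by apply: (herm_domB hrmN) => //; exact: qE.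
  have -> : mid v v' - u = (2^-1)%:C *: ((v - u) + (v' - u)).
    rewrite /mid addrACA -opprD scalerBr; congr (_ - _).
    apply/funext => x; change (u x = (2^-1)%:C * (u x + u x)).
    by apply: complex_eq; rewrite !cReImE /=; field.
  rewrite (qform_half hrmN)//.
  move: (n.+1%:R^-1) (psd_ge0 psdN (herm_domB hrmN vE vE')) vu vu' => r.
  by move=> h1 h2 h3; lra.
- move=> v v' [qv _] [qv' _]; split.
  + by apply: (psd_ge0 psdQ); exact: (herm_domB hrmQ).
  + exact: (qform_distC hrmQ).
  + exact: (qform_half hrmQ).
- by move=> v [qv _]; exact: (psd_ge0 psdQ).
- have [|v [qv vu vM]] := hM n.+1%:R^-1; first by rewrite invr_gt0.
  by exists v.
exists s; apply/(form_cvgE _ _ qsb qa); split=> //.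
- by move=> n; exact: (sC n).1.
- apply: cvg0_le (@cvg_harmonic R) => n; last exact: (sC n).2.
  by apply: (psd_ge0 psdN); apply: (herm_domB hrmN) => //; apply: qE; exact: (sC n).1.
Qed.

End Semibounded.

(** * A closed form is determined by its operator *)

Section Representation.
Context {R : realType} {X : countType} {mu : X -> R}.
Hypothesis mu0 : forall x, 0 < mu x.
Implicit Types (q : sform R X) (u v f : X -> R[i]) (s t : nat -> X -> R[i]).
Let mu0' x : 0 <= mu x := ltW (mu0 x).
Local Notation N := (qform (inner mu)).
Let psdN := inner_psd mu0'.
Let hrmN := psd_herm psdN.

(** The first-order condition at a minimum. *)
Lemma quadratic_ge0_eq0 (r c : R) :
  (forall t : R, 0 <= 2 * t * r + t ^+ 2 * c) -> r = 0.
Proof.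
move=> h; pose k := `|c| + 1.
have k0 : 0 < k by rewrite ltr_wpDl.
have ck : 0 < 2 * k - c by have := ler_norm c; rewrite /k in k0 *; lra.
have := h (- r / k).
have -> : 2 * (- r / k) * r + (- r / k) ^+ 2 * c = - (r ^+ 2 * (2 * k - c) / k ^+ 2).
  by field; rewrite gt_eqF.
rewrite oppr_ge0 pmulr_lle0 ?invr_gt0 ?exprn_gt0// pmulr_lle0// => r0.
by apply/eqP; rewrite -sqrf_eq0 eq_le r0 sqr_ge0.
Qed.

(** The solution minimises [Q v - 2 Re (f, v)]; minimising sequences are Cauchy by
    [near_minimisers] and converge because [q] is closed. *)
Lemma riesz_representation q a f : closed_form mu q -> coercive mu q a -> ell2 mu f ->
  exists2 u, fdom q u & forall v, fdom q v -> shift mu q a u v = inner mu f v.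
Proof.
move=> qc qa fE; have qsb := closed_semibounded mu0 qc; have [qE _ _] := qsb.
have psdQ := shift_psd mu0 qsb qa; have hrmQ := psd_herm psdQ.
pose J v := qform (shift mu q a) v - 2 * complex.Re (inner mu f v).
pose mid u v : X -> R[i] := (2^-1)%:C *: (u + v).
have [||||n|s [sq smin hs]] := @near_minimisers R _ (fun _ => fdom q) J mid
  (fun u v => qform (shift mu q a) (u - v)) (- N f) 0.
- by move=> n m _ v.
- by move=> _ v v' qv qv'; apply: (herm_domZ hrmQ); exact: (herm_domD hrmQ).
- move=> v v' qv qv'; split.
  + by apply: (psd_ge0 psdQ); exact: (herm_domB hrmQ).
  + exact: (qform_distC hrmQ).
  + have [vE vE'] := (qE _ qv, qE _ qv').
    rewrite /J /mid (qform_half hrmQ)// (hermZr hrmN)//; last exact: (herm_domD hrmN).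
    by rewrite (hermDr hrmN)// !cReImE /=; field.
- move=> v qv; have vE := qE _ qv; rewrite /J.
  have := psd_ge0 psdN (herm_domB hrmN fE vE); rewrite (qformB hrmN)//.
  have := qa _ qv; lra.
- exists 0; first exact: (herm_dom0 hrmQ).
  by rewrite /J (qform0 hrmQ) (herm0r hrmN fE) /= mulr0 subr0.
have sE n : ell2 mu (s n) by exact: qE.
have [u uE uc] : exists2 u, ell2 mu u & N (s n - u) @[n --> \oo] --> (0 : R).
  apply: (ell2_complete mu0) => //; apply: cvg0_le hs => p.
    by apply: (psd_ge0 psdN); exact: (herm_domB hrmN).
  by apply: qa; exact: (herm_domB hrmQ).
have su : form_cvg mu q s u by apply/(form_cvgE mu0 _ _ qsb qa).
have [qu sQ] := closed_cvg mu0 qc qa su.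
exists u => //.
have key v : fdom q v -> complex.Re (shift mu q a u v) = complex.Re (inner mu f v).
  move=> qv; have vE := qE _ qv.
  apply/eqP; rewrite -subr_eq0; apply/eqP.
  apply: (@quadratic_ge0_eq0 _ (qform (shift mu q a) v)) => t.
  have limB : complex.Re (shift mu q a (s n) v) @[n --> \oo] -->
      complex.Re (shift mu q a u v).
    have vQ : qform (shift mu q a) (v - v) @[n --> \oo] --> (0 : R).
      by rewrite subrr (qform0 hrmQ); exact: cvg_cst.
    apply: (proj1 (A := _) (B := complex.Im (shift mu q a (s n) v) @[n --> \oo] -->
      complex.Im (shift mu q a u v))).
    by apply/cvg_complexP; exact: (psd_cvg psdQ qu qv sq (fun _ => qv) sQ vQ).
  have lim : 2 * t * (complex.Re (shift mu q a (s n) v) - complex.Re (inner mu f v)) +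
      t ^+ 2 * qform (shift mu q a) v + n.+1%:R^-1 @[n --> \oo] -->
      2 * t * (complex.Re (shift mu q a u v) - complex.Re (inner mu f v)) +
      t ^+ 2 * qform (shift mu q a) v + 0.
    apply: cvgD; last exact: cvg_harmonic.
    apply: cvgD; last exact: cvg_cst.
    apply: cvgM; first exact: cvg_cst.
    by apply: cvgB => //; exact: cvg_cst.
  rewrite addr0 in lim; apply: (cvgr_to_ge lim); apply: nearW => n.
  have tvq : fdom q (t%:C *: v) by exact: (herm_domZ hrmQ).
  have := smin n _ (herm_domD hrmQ (sq n) tvq).
  rewrite /J (qformD hrmQ)// (qformZ hrmQ)// (hermZr hrmQ)//.
  rewrite (hermDr hrmN)//; [|exact: qE..].
  rewrite (hermZr hrmN)// !cReImE /=.
  move: (n.+1%:R^-1) => r h.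
  rewrite -subr_ge0 in h; apply: le_trans h _; rewrite le_eqVlt; apply/orP; left.
  by apply/eqP; ring.
move=> v qv; apply: complex_eq; first exact: key.
rewrite (Im_herm hrmQ)// (Im_herm hrmN)//; last exact: qE.
by apply: key; exact: (herm_domZ hrmQ).
Qed.

(** In operator terms, [A + a] is onto. *)
Lemma riesz_operator q a f : closed_form mu q -> coercive mu q a -> ell2 mu f ->
  exists2 u, form_operator mu q (u, f - a%:C *: u) &
    forall v, fdom q v -> shift mu q a u v = inner mu f v.
Proof.
move=> qc qa fE; have [u qu uv] := riesz_representation qc qa fE; exists u => //.
have qE := cf_ell2 qc; have uE := qE _ qu.
have auE : ell2 mu (a%:C *: u) by exact: (herm_domZ hrmN).
split=> //=; first exact: (herm_domB hrmN).
move=> v qv; have vE := qE _ qv.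
by rewrite (hermBl hrmN)// -uv// (hermZl hrmN)// /shift addrK.
Qed.

Definition op_restriction q : sform R X :=
  {| fdom := [set u | exists f, form_operator mu q (u, f)]; fval := fval q |}.

Lemma op_restriction_dom q : fdom (op_restriction q) `<=` fdom q.
Proof. by move=> u [f []]. Qed.

Lemma op_restriction_semibounded q : semibounded_form mu q ->
  semibounded_form mu (op_restriction q).
Proof.
move=> [qE qh [c hc]]; have sub := @op_restriction_dom q.
split; first by move=> u /sub/qE.
- split.
  + exists 0; split=> /=; [exact: (herm_dom0 qh)|exact: (herm_dom0 hrmN)|].
    by move=> v qv; rewrite (herm0l qh)// (herm0l hrmN)//; exact: qE.
  + move=> a u v [f [/= qu fE uf]] [g [/= qv gE vg]].
    exists (a *: f + g); split=> /=.
    * exact: (herm_domP qh).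
    * exact: (herm_domP hrmN).
    * move=> z qz; rewrite (herm_linear qh)// uf// vg// (herm_linear hrmN)//.
      exact: qE.
  + move=> a u v z /sub qu /sub qv /sub qz; exact: (herm_linear qh).
  + move=> u v /sub qu /sub qv; exact: (herm_sym qh).
- by exists c => u /sub; exact: hc.
Qed.

(** The resolvent approximations [v = k (A + a + k)^-1 u] satisfy
    [Q v + 2 k |v - u|^2 <= Q u]: they have bounded energy and tend to [u] in
    l^2 as [k] grows. *)
Lemma op_domain_core q u : closed_form mu q -> fdom q u ->
  exists s, form_cvg mu (op_restriction q) s u.
Proof.
move=> qc qu; have qsb := closed_semibounded mu0 qc; have [qE qh _] := qsb.
have [a ha] := semibounded_coercive mu0 qsb.
have qa := ha a (lexx a); have uE := qE _ qu.
have psdQ := shift_psd mu0 qsb qa; have hrmQ := psd_herm psdQ.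
apply: (@bounded_energy_form_cvg _ _ _ mu0 (op_restriction q) a _
  (qform (shift mu q a) u)) => //.
- exact: op_restriction_semibounded.
- by move=> v /op_restriction_dom; exact: qa.
move=> e e0; have Qu := psd_ge0 psdQ qu.
pose k := (qform (shift mu q a) u + 1) / e.
have k0 : 0 < k by rewrite divr_gt0// ltr_wpDl.
have ke : k * e = qform (shift mu q a) u + 1 by rewrite /k mulfVK ?gt_eqF.
clearbody k.
have kuE : ell2 mu (k%:C *: u) by exact: (herm_domZ hrmN).
have qak : coercive mu q (a + k) by apply: ha; rewrite lerDl ltW.
have [v vop vz] := riesz_operator qc qak kuE.
have qv : fdom q v by case: vop.
have vE := qE _ qv; have vuE := herm_domB hrmN vE uE.
have qvu := herm_domB hrmQ qv qu.
(* The equation of [v] tested against [v - u]. *)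
have eqn : complex.Re (shift mu q a v (v - u)) = - k * N (v - u).
  have := congr1 (@complex.Re R) (vz _ qvu).
  have -> : shift mu q (a + k) v (v - u) =
      shift mu q a v (v - u) + k%:C * inner mu v (v - u).
    by rewrite /shift rmorphD /=; ring.
  have -> : N (v - u) =
      complex.Re (inner mu v (v - u)) - complex.Re (inner mu u (v - u)).
    by rewrite /qform (hermBl hrmN)// !cReImE.
  rewrite (hermZl hrmN)// !cReImE /=; lra.
rewrite (hermBr hrmQ)// cReD cReN -/(qform (shift mu q a) v) in eqn.
have Qvu := psd_ge0 psdQ qvu; rewrite (qformB hrmQ)// in Qvu.
have Nvu := psd_ge0 psdN vuE; have kN := mulr_ge0 (ltW k0) Nvu.
have Qv := psd_ge0 psdQ qv.
exists v; split; first by exists (k%:C *: u - (a + k)%:C *: v).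
  by rewrite -(ler_pM2l k0) ke; lra.
by lra.
Qed.

(** Both forms agree with [(A u, v)] on the domain of the common operator [A], and
    that domain is a core of each of them. *)
Lemma closed_form_unique q q' : closed_form mu q -> closed_form mu q' ->
  form_operator mu q = form_operator mu q' ->
  fdom q = fdom q' /\ forall u v, fdom q u -> fdom q v -> fval q u v = fval q' u v.
Proof.
have transfer q1 q2 : closed_form mu q1 -> closed_form mu q2 ->
    form_operator mu q1 = form_operator mu q2 ->
    forall s u, form_cvg mu (op_restriction q1) s u -> form_cvg mu q2 s u.
  move=> q1c q2c opE s u [uE sop sN sq].
  have sop2 n : fdom (op_restriction q2) (s n).
    by have [f hf] := sop n; exists f; rewrite -opE.
  split=> // [n|]; first exact: op_restriction_dom (sop2 n).
  have qsb := op_restriction_semibounded (closed_semibounded mu0 q1c).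
  have -> : (fun p : nat * nat => fval q2 (s p.1 - s p.2) (s p.1 - s p.2)) =
     (fun p => fval q1 (s p.1 - s p.2) (s p.1 - s p.2)); last exact: sq.
  apply/funext => p; have [f fop] := herm_domB (sb_herm qsb) (sop p.1) (sop p.2).
  have [/= q1d _ ->//] := fop; move: fop; rewrite opE => -[/= q2d _ ->//].
move=> qc q'c opE.
have domE : fdom q = fdom q'.
  apply/seteqP; split=> u qu.
    have [s /(transfer _ _ qc q'c opE)] := op_domain_core qc qu.
    by case/(cf_closed q'c).
  have [s /(transfer _ _ q'c qc (esym opE))] := op_domain_core q'c qu.
  by case/(cf_closed qc).
split=> // u v qu qv.
have [s su] := op_domain_core qc qu; have [t tv] := op_domain_core qc qv.
have self := transfer _ _ qc qc erefl; have other := transfer _ _ qc q'c opE.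
have lim q1 : closed_form mu q1 -> form_cvg mu q1 s u -> form_cvg mu q1 t v ->
    fval q1 (s n) (t n) @[n --> \oo] --> (fval q1 u v : R[i]^o).
  move=> q1c su1 tv1; have q1sb := closed_semibounded mu0 q1c.
  have [q1E _ _] := q1sb.
  have [a ha] := semibounded_coercive mu0 q1sb; have q1a := ha a (lexx a).
  have psdQ := shift_psd mu0 q1sb q1a.
  have [uE sq sN _] := (form_cvgE mu0 s u q1sb q1a).1 su1.
  have [vE tq tN _] := (form_cvgE mu0 t v q1sb q1a).1 tv1.
  have [qu1 sQ] := closed_cvg mu0 q1c q1a su1.
  have [qv1 tQ] := closed_cvg mu0 q1c q1a tv1.
  have h1 : shift mu q1 a (s n) (t n) @[n --> \oo] --> (shift mu q1 a u v : R[i]^o).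
    exact: (psd_cvg psdQ qu1 qv1 sq tq sQ tQ).
  have h2 : inner mu (s n) (t n) @[n --> \oo] --> (inner mu u v : R[i]^o).
    exact: (psd_cvg psdN uE vE (fun n => q1E _ (sq n)) (fun n => q1E _ (tq n)) sN tN).
  have -> : (fun n => fval q1 (s n) (t n)) =
    (fun n => shift mu q1 a (s n) (t n) - a%:C * inner mu (s n) (t n)).
    by apply/funext => n; rewrite /shift addrK.
  have -> : fval q1 u v = shift mu q1 a u v - a%:C * inner mu u v.
    by rewrite /shift addrK.
  have h3 : a%:C * inner mu (s n) (t n) @[n --> \oo] --> (a%:C * inner mu u v : R[i]^o).
    by apply: (@cvgM R[i]); [exact: cvg_cst|exact: h2].
  exact: (@cvgB _ R[i]^o _ _ _ (fun n => shift mu q1 a (s n) (t n)) _ _ _ h1 h3).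
have l1 := lim _ qc (self _ _ su) (self _ _ tv).
have l2 := lim _ q'c (other _ _ su) (other _ _ tv).
apply: (@cvg_unique R[i]^o _ _ _ _ _ l1 _); first exact: norm_hausdorff.
have -> // : (fun n => fval q (s n) (t n)) = (fun n => fval q' (s n) (t n)).
apply/funext => n; have [_ sop _ _] := su; have [_ top _ _] := tv.
have [f [/= fop fE fq]] := sop n; rewrite fq; last exact: op_restriction_dom (top n).
have : form_operator mu q' (s n, f) by rewrite -opE.
by move=> [/= _ _ ->//]; rewrite -domE; exact: op_restriction_dom (top n).
Qed.

Lemma form_operator_eq q q' : fdom q = fdom q' ->
  (forall u v, fdom q u -> fdom q v -> fval q u v = fval q' u v) ->
  form_operator mu q = form_operator mu q'.
Proof.
move=> domE valE; apply/seteqP; split=> -[u f] [/= qu fE hf].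
  by split=> //=; rewrite -?domE// => v qv; rewrite -valE ?hf.
by split=> //=; rewrite ?domE// => v qv; rewrite valE ?domE ?hf// -domE.
Qed.

End Representation.

(** * The closure of a form *)

Section Closure.
Context {R : realType} {X : countType} {mu : X -> R}.
Hypothesis mu0 : forall x, 0 < mu x.
Implicit Types (q : sform R X) (u v f : X -> R[i]) (s t : nat -> X -> R[i]).
Let mu0' x : 0 <= mu x := ltW (mu0 x).
Local Notation N := (qform (inner mu)).
Let psdN := inner_psd mu0'.
Let hrmN := psd_herm psdN.

(** With the inner product [shift mu q a] at hand, closedness only concerns the
    convergence of its quadratic form. *)
Lemma closed_formI q a : semibounded_form mu q -> coercive mu q a ->
  (forall u, ell2 mu u -> forall e, 0 < e -> exists2 v, fdom q v & N (u - v) < e) ->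
  (forall s u, form_cvg mu q s u ->
    fdom q u /\ qform (shift mu q a) (s n - u) @[n --> \oo] --> (0 : R)) ->
  closed_form mu q.
Proof.
move=> qsb qa dense closed; have [qE qh [c hc]] := qsb; have [q0 qP qlin qherm] := qh.
split=> //.
- exists c => u qu; rewrite lecE (herm_real qh qu) eqxx /=.
  by rewrite (ell2_normX mu0') ?hc//; exact: qE.
- move=> u uE e e0; have [v qv uv] := dense u uE (e ^+ 2) (exprn_gt0 2 e0).
  exists v => //; rewrite ell2_normE.
  by rewrite -[ltRHS]ger0_norm ?(ltW e0)// -sqrtr_sqr ltr_sqrt// exprn_gt0.
- move=> s u su; have [qu sQ] := closed s u su; split=> //.
  have [uE sq sN _] := (form_cvgE mu0 s u qsb qa).1 su.
  apply/cvg0_complex_realP.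
    by move=> n; apply: (herm_real qh); exact: (herm_domB qh).
  have -> : (fun n => complex.Re (fval q (s n - u) (s n - u))) =
    (fun n => qform (shift mu q a) (s n - u) - a * N (s n - u)).
    by apply/funext => n; rewrite qform_shift addrK.
  rewrite -[X in _ --> X](subr0 (0 : R)) -[X in _ --> _ - X](mulr0 a).
  by apply: cvgB => //; apply: cvgM => //; exact: cvg_cst.
Qed.

Section ClosureOfForm.
Context {q : sform R X} {a : R}.
Hypothesis qsb : semibounded_form mu q.
Hypothesis qa : coercive mu q a.
(** Every functional [fval q u] is bounded for the norm of l^2: it comes from a
    symmetric operator, which is what makes the form closable. *)
Hypothesis qclos : forall u, fdom q u -> exists c : R, forall v, fdom q v ->
  complex.Re (fval q u v) ^+ 2 <= c * N v.
Local Notation B := (shift mu q a).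
Local Notation Q := (qform (shift mu q a)).
Local Notation h := (form_closure mu q).
Let qE := sb_ell2 qsb.
Let qh := sb_herm qsb.
Let psdQ := shift_psd mu0 qsb qa.
Let hrmQ := psd_herm psdQ.

Lemma form_cvg_lin (b : R[i]) s t u v : form_cvg mu q s u -> form_cvg mu q t v ->
  form_cvg mu q (fun n => b *: s n + t n) (b *: u + v).
Proof.
move=> /(form_cvgE mu0 _ _ qsb qa)[uE sq sN sQ].
move=> /(form_cvgE mu0 _ _ qsb qa)[vE tq tN tQ].
pose k := complex.Re b ^+ 2 + complex.Im b ^+ 2.
have subE (s1 s2 t1 t2 : X -> R[i]) :
    b *: s1 + t1 - (b *: s2 + t2) = b *: (s1 - s2) + (t1 - t2).
  by rewrite scalerBr opprD addrACA.
have lim (T : Type) (F : set_system T) (FF : Filter F) (x y : T -> R) :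
    x i @[i --> F] --> (0 : R) -> y i @[i --> F] --> (0 : R) ->
    2 * (k * x i) + 2 * y i @[i --> F] --> (0 : R).
  move=> hx hy; rewrite [X in _ --> X](_ : 0 = 2 * (k * 0) + 2 * 0); last by ring.
  apply: cvgD; apply: cvgM => //; try exact: cvg_cst.
  by apply: cvgM => //; exact: cvg_cst.
apply/(form_cvgE mu0 _ _ qsb qa); split.
- exact: (herm_domP hrmN).
- by move=> n; exact: (herm_domP hrmQ).
- apply: cvg0_le (lim _ _ _ _ _ sN tN) => n; rewrite subE.
    apply: (psd_ge0 psdN); apply: (herm_domP hrmN); apply: (herm_domB hrmN) => //;
      exact: qE.
  have dE : ell2 mu (s n - u) by apply: (herm_domB hrmN) => //; exact: qE.
  rewrite -(qformZ hrmN b dE); apply: (qformD_le psdN); first exact: (herm_domZ hrmN).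
  by apply: (herm_domB hrmN) => //; exact: qE.
- apply: cvg0_le (lim _ _ _ _ _ sQ tQ) => p; rewrite subE.
    by apply: (psd_ge0 psdQ); apply: (herm_domP hrmQ); exact: (herm_domB hrmQ).
  have dq : fdom q (s p.1 - s p.2) by exact: (herm_domB hrmQ).
  rewrite -(qformZ hrmQ b dq); apply: (qformD_le psdQ); first exact: (herm_domZ hrmQ).
  exact: (herm_domB hrmQ).
Qed.

Lemma form_cvg_cst u : fdom q u -> form_cvg mu q (fun=> u) u.
Proof.
move=> qu; apply/(form_cvgE mu0 _ _ qsb qa); split=> //; first exact: qE.
  by rewrite subrr (qform0 hrmN); exact: cvg_cst.
by rewrite subrr (qform0 hrmQ); exact: cvg_cst.
Qed.

Lemma form_cvgB s t u v : form_cvg mu q s u -> form_cvg mu q t v ->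
  form_cvg mu q (fun n => s n - t n) (u - v).
Proof.
move=> su tv; have := form_cvg_lin (-1) tv su.
by rewrite scaleN1r addrC; under eq_fun do rewrite scaleN1r addrC.
Qed.

(** [Q (s n)] is at most [Q (s n - s m) + 2 Re B (s n) (s m)]; for fixed [n] the
    last term vanishes as [m] grows because [s m] tends to zero in l^2. *)
Lemma form_closable s : form_cvg mu q s 0 -> Q (s n) @[n --> \oo] --> (0 : R).
Proof.
move=> /(form_cvgE mu0 _ _ qsb qa)[_ sq sN sQ].
have {}sN : N (s n) @[n --> \oo] --> (0 : R).
  have -> // : (fun n => N (s n)) = (fun n => N (s n - 0)).
  by apply/funext => n; rewrite subr0.
have lim n : complex.Re (B (s n) (s m)) @[m --> \oo] --> (0 : R).
  have [c hc] := qclos (sq n).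
  have hb m : complex.Re (B (s n) (s m)) ^+ 2 <= 2 * (c + a ^+ 2 * N (s n)) * N (s m).
    rewrite /shift cReD cReMr.
    have h1 := hc _ (sq m); have h2 := psd_cauchy_schwarz psdN (qE (sq n)) (qE (sq m)).
    move: (complex.Re (fval q _ _)) (complex.Re (inner mu _ _)) h1 h2 => x y h1 h2.
    have h3 := ler_wpM2l (sqr_ge0 a) h2; have h4 := sqr_ge0 (x - a * y).
    have -> : (x + a * y) ^+ 2 = 2 * x ^+ 2 + 2 * (a ^+ 2 * y ^+ 2) - (x - a * y) ^+ 2.
      by ring.
    move: (N (s n)) (N (s m)) h1 h3 h4 => Nn Nm h1 h3 h4.
    have -> : 2 * (c + a ^+ 2 * Nn) * Nm = 2 * (c * Nm) + 2 * (a ^+ 2 * (Nn * Nm)).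
      by ring.
    lra.
  apply/norm_cvg0P; under eq_fun do rewrite -sqrtr_sqr.
  apply: cvg0_sqrt; apply: (cvg0_le _ hb); first by move=> m; exact: sqr_ge0.
  rewrite -[X in _ --> X](mulr0 (2 * (c + a ^+ 2 * N (s n)))).
  by apply: cvgM => //; exact: cvg_cst.
move/cvg0_seq2P : sQ => sQ; apply/cvg0_seqP => e e0.
have [M hM] := sQ (e / 2) (divr_gt0 e0 (ltr0Sn _ 1)); exists M => n Mn.
rewrite ger0_norm ?(psd_ge0 psdQ)//.
suff : Q (s n) <= e / 2 by lra.
have lim2 : e / 2 + 2 * complex.Re (B (s n) (s m)) @[m --> \oo] --> e / 2 + 2 * 0.
  by apply: cvgD; [exact: cvg_cst|apply: cvgM; [exact: cvg_cst|exact: lim]].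
rewrite mulr0 addr0 in lim2; apply: (cvgr_to_ge lim2).
exists M => // m /= Mm; have := hM n m Mn Mm; have Qm := psd_ge0 psdQ (sq m).
have -> /= := qformB hrmQ (sq n) (sq m).
by rewrite ltr_norml => /andP[_]; lra.
Qed.

Lemma form_cvg_energy s u : form_cvg mu q s u ->
  [/\ ell2 mu u, forall n, fdom q (s n), N (s n - u) @[n --> \oo] --> (0 : R)
    & Q (s p.1 - s p.2) @[p --> (\oo, \oo)] --> (0 : R)].
Proof. by move/(form_cvgE mu0 _ _ qsb qa). Qed.

Lemma form_cvg_shift s t u v (z : R[i]) : form_cvg mu q s u -> form_cvg mu q t v ->
  fval q (s n) (t n) @[n --> \oo] --> (z : R[i]^o) <->
  B (s n) (t n) @[n --> \oo] --> (z + a%:C * inner mu u v : R[i]^o).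
Proof.
move=> /form_cvg_energy[uE sq sN _] /form_cvg_energy[vE tq tN _].
have h2 : inner mu (s n) (t n) @[n --> \oo] --> (inner mu u v : R[i]^o).
  exact: (psd_cvg psdN uE vE (fun n => qE (sq n)) (fun n => qE (tq n)) sN tN).
have h3 : a%:C * inner mu (s n) (t n) @[n --> \oo] --> (a%:C * inner mu u v : R[i]^o).
  by apply: (@cvgM R[i]); [exact: cvg_cst|exact: h2].
split=> h1.
  exact: (@cvgD _ R[i]^o _ _ _ (fun n => fval q (s n) (t n)) _ _ _ h1 h3).
have -> : (fun n => fval q (s n) (t n)) =
  (fun n => B (s n) (t n) - a%:C * inner mu (s n) (t n)).
  by apply/funext => n; rewrite /shift addrK.
rewrite -[z](addrK (a%:C * inner mu u v)).
exact: (@cvgB _ R[i]^o _ _ _ (fun n => B (s n) (t n)) _ _ _ h1 h3).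
Qed.

(** The limit exists because the sequences are Cauchy, and closability makes it
    independent of the approximating sequences. *)
Lemma closure_cvg s t u v : form_cvg mu q s u -> form_cvg mu q t v ->
  B (s n) (t n) @[n --> \oo] --> (shift mu h a u v : R[i]^o).
Proof.
move=> su tv; have [uE sq sN sQ] := form_cvg_energy su.
have [vE tq tN tQ] := form_cvg_energy tv.
have [z0 hz0] := psd_cauchy_cvg psdQ sq tq sQ tQ.
apply/(form_cvg_shift _ su tv); rewrite /form_closure /=.
set P := [set z : R[i] | _].
have Pz0 : P (z0 - a%:C * inner mu u v).
  exists s, t; split; [exact: su|exact: tv|].
  by apply/(form_cvg_shift _ su tv); rewrite subrK; exact: hz0.
have [s' [t' [su' tv' lim']]] := xgetPex 0 (ex_intro P _ Pz0).
move/(form_cvg_shift _ su' tv') in lim'; apply/(form_cvg_shift _ su tv).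
set z := _ + _ in lim' *.
have [_ sq' _ sQ'] := form_cvg_energy su'; have [_ tq' _ tQ'] := form_cvg_energy tv'.
have [c hc] := psd_cauchy_bounded psdQ tq tQ.
have [d hd] := psd_cauchy_bounded psdQ sq' sQ'.
have ds : Q (s n - s' n) @[n --> \oo] --> (0 : R).
  by apply: form_closable; rewrite -(subrr u); exact: form_cvgB.
have dt : Q (t n - t' n) @[n --> \oo] --> (0 : R).
  by apply: form_closable; rewrite -(subrr v); exact: form_cvgB.
have qds n : fdom q (s n - s' n) by exact: (herm_domB hrmQ).
have qdt n : fdom q (t n - t' n) by exact: (herm_domB hrmQ).
have l1 : B (s n - s' n) (t n) @[n --> \oo] --> (0 : R[i]^o).
  exact: (psd_cvg0_bounded psdQ qds tq ds hc).1.
have l2 : B (s' n) (t n - t' n) @[n --> \oo] --> (0 : R[i]^o).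
  exact: (psd_cvg0_bounded psdQ qdt sq' dt hd).2.
have -> : (fun n => B (s n) (t n)) =
   (fun n => B (s' n) (t' n) + (B (s n - s' n) (t n) + B (s' n) (t n - t' n))).
  by apply/funext => n; rewrite (hermBl hrmQ)// (hermBr hrmQ)//; ring.
have l3 : B (s n - s' n) (t n) + B (s' n) (t n - t' n) @[n --> \oo] --> (0 : R[i]^o).
  rewrite -[X in _ --> X]addr0.
  exact: (@cvgD _ R[i]^o _ _ _ (fun n => B (s n - s' n) (t n)) _ _ _ l1 l2).
rewrite -[z]addr0.
exact: (@cvgD _ R[i]^o _ _ _ (fun n => B (s' n) (t' n)) _ _ _ lim' l3).
Qed.

Lemma closure_val u v : fdom q u -> fdom q v -> fval h u v = fval q u v.
Proof.
move=> qu qv; have lim := closure_cvg (form_cvg_cst qu) (form_cvg_cst qv).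
have : shift mu h a u v = B u v.
  apply: (@cvg_unique R[i]^o _ _ _ _ _ lim _); first exact: norm_hausdorff.
  exact: cvg_cst.
by move/addIr.
Qed.

Lemma closure_sub : fdom q `<=` fdom h.
Proof. by move=> u qu; exists (fun=> u); exact: form_cvg_cst. Qed.

Lemma closure_herm : herm_form (fdom h)
  (shift mu h a : (X -> R[i]) -> (X -> R[i]) -> R[i]).
Proof.
split.
- by apply: closure_sub; exact: (herm_dom0 hrmQ).
- by move=> b u v [s su] [t tv]; exists (fun n => b *: s n + t n); exact: form_cvg_lin.
- move=> b u v w [s su] [t tv] [r rw].
  have l1 := closure_cvg su rw; have l2 := closure_cvg tv rw.
  have l3 := closure_cvg (form_cvg_lin b su tv) rw.
  apply: (@cvg_unique R[i]^o _ _ _ _ _ l3 _); first exact: norm_hausdorff.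
  have [_ sq _ _] := form_cvg_energy su; have [_ tq _ _] := form_cvg_energy tv.
  have [_ rq _ _] := form_cvg_energy rw.
  have -> : (fun n => B (b *: s n + t n) (r n)) =
      (fun n => b * B (s n) (r n) + B (t n) (r n)).
    by apply/funext => n; exact: (herm_linear hrmQ).
  have l4 : b * B (s n) (r n) @[n --> \oo] --> (b * shift mu h a u w : R[i]^o).
    by apply: (@cvgM R[i]); [exact: cvg_cst|exact: l1].
  exact: (@cvgD _ R[i]^o _ _ _ (fun n => b * B (s n) (r n)) _ _ _ l4 l2).
- move=> u v [s su] [t tv].
  have l1 := closure_cvg su tv; have l2 := closure_cvg tv su.
  have [_ sq _ _] := form_cvg_energy su; have [_ tq _ _] := form_cvg_energy tv.
  apply: (@cvg_unique R[i]^o _ _ _ _ _ l2 _); first exact: norm_hausdorff.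
  have -> : (fun n => B (t n) (s n)) = (fun n => (B (s n) (t n))^* ).
    by apply/funext => n; exact: (herm_sym hrmQ).
  move/cvg_complexP : l1 => [lR lI]; apply/cvg_complexP; split.
    by rewrite cReJ; under eq_fun do rewrite cReJ.
  by rewrite cImJ; under eq_fun do rewrite cImJ; exact: cvgN.
Qed.

Lemma closure_coercive : coercive mu h a.
Proof.
move=> u [s su]; have [uE sq sN _] := form_cvg_energy su.
have /cvg_complexP[lB _] := closure_cvg su su.
have lN : inner mu (s n) (s n) @[n --> \oo] --> (inner mu u u : R[i]^o).
  exact: (psd_cvg psdN uE uE (fun n => qE (sq n)) (fun n => qE (sq n)) sN sN).
move/cvg_complexP : lN => [lN _].
by apply: (ler_cvg_to lN lB); apply: nearW => n; exact: qa.
Qed.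

Lemma closure_semibounded : semibounded_form mu h.
Proof.
have [h0 hP hlin hsym] := closure_herm.
have hE : fdom h `<=` ell2 mu by move=> u [s /form_cvg_energy[]].
have valE u v : fval h u v = shift mu h a u v - a%:C * inner mu u v.
  by rewrite /shift addrK.
split=> //.
- split=> // [b u v w hu hv hw|u v hu hv].
    rewrite !valE hlin// (herm_linear hrmN); [ring|exact: hE..].
  rewrite !valE hsym// (herm_sym hrmN (hE _ hu) (hE _ hv)).
  move: (shift mu h a u v) (inner mu u v) => x y.
  by apply: complex_eq; rewrite !cReImE /=; ring.
- exists (1 - a) => u hu; have := closure_coercive hu.
  by rewrite qform_shift mulrBl mul1r lerBlDr.
Qed.

(** For fixed [n], [s n - s m] approximates [s n - u], so the energy of the latter
    is a limit of energies that are small for large [n]. *)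
Lemma closure_energy_cvg s u : form_cvg mu q s u ->
  qform (shift mu h a) (s n - u) @[n --> \oo] --> (0 : R).
Proof.
move=> su; have [uE sq sN /cvg0_seq2P sQ] := form_cvg_energy su.
apply/cvg0_seqP => e e0; have [M hM] := sQ (e / 2) (divr_gt0 e0 (ltr0Sn _ 1)).
exists M => n Mn.
have dcvg := form_cvgB (form_cvg_cst (sq n)) su.
have hd : fdom h (s n - u) by exists (fun m => s n - s m).
have /cvg_complexP[lim _] := closure_cvg dcvg dcvg.
have psdH := shift_psd mu0 closure_semibounded closure_coercive.
rewrite ger0_norm ?(psd_ge0 psdH)//.
suff : qform (shift mu h a) (s n - u) <= e / 2 by lra.
apply: (cvgr_to_le lim); exists M => // m /= Mm.
by have := hM n m Mn Mm; rewrite ltr_norml => /andP[_ /ltW].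
Qed.

(** A diagonal argument: replace each term of a Cauchy sequence of the closure by a
    nearby element of the original domain. *)
Lemma closure_closed :
  (forall u, ell2 mu u -> forall e, 0 < e -> exists2 v, fdom q v & N (u - v) < e) ->
  closed_form mu h.
Proof.
move=> dense; have hsb := closure_semibounded; have ha := closure_coercive.
have [hE _ _] := hsb; have psdH := shift_psd mu0 hsb ha; have hrmH := psd_herm psdH.
apply: (closed_formI hsb ha).
  by move=> u uE e e0; have [v /closure_sub hv uv] := dense u uE e e0; exists v.
move=> s u /(form_cvgE mu0 _ _ hsb ha)[uE sh sN sH].
have /choice[f hf] : forall n, exists v,
    fdom q v /\ qform (shift mu h a) (v - s n) <= n.+1%:R^-1.
  move=> n; have [t ts] := sh n; have [_ tq _ _] := form_cvg_energy ts.
  have e0 : 0 < n.+1%:R^-1 :> R by rewrite invr_gt0.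
  have [M hM] := (cvg0_seqP _).1 (closure_energy_cvg ts) _ e0.
  exists (t M); split=> //; apply: ltW; apply: le_lt_trans (hM M (leqnn M)).
  exact: ler_norm.
have fq n : fdom q (f n) := (hf n).1.
have fh n : fdom h (f n) by exact: closure_sub.
have fsH : qform (shift mu h a) (f n - s n) @[n --> \oo] --> (0 : R).
  apply: (cvg0_le _ _ (@cvg_harmonic R)) => n; last exact: (hf n).2.
  by apply: (psd_ge0 psdH); exact: (herm_domB hrmH).
have uf : form_cvg mu q f u.
  apply/(form_cvgE mu0 _ _ qsb qa); split=> //.
    apply: (@cvg0_le _ _ _ _ _
      (fun n => 2 * qform (shift mu h a) (f n - s n) + 2 * N (s n - u))).
    - by move=> n; apply: (psd_ge0 psdN); apply: (herm_domB hrmN) => //; exact: hE.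
    - move=> n; apply: le_trans (qformB_le psdN (hE _ (fh n)) (hE _ (sh n)) uE) _.
      rewrite lerD2r ler_pM2l// ha//; exact: (herm_domB hrmH).
    rewrite [X in _ --> X](_ : 0 = 2 * 0 + 2 * 0); last by ring.
    by apply: cvgD; apply: cvgM => //; exact: cvg_cst.
  have -> : (fun p : nat * nat => Q (f p.1 - f p.2)) =
      (fun p => qform (shift mu h a) (f p.1 - f p.2)).
    apply/funext => p; rewrite /qform /shift closure_val//; exact: (herm_domB hrmQ).
  apply: (@cvg0_le _ _ _ _ _ (fun p => 2 * qform (shift mu h a) (f p.1 - s p.1) +
    2 * (2 * qform (shift mu h a) (s p.1 - s p.2) +
         2 * qform (shift mu h a) (f p.2 - s p.2)))).
  - by move=> p; apply: (psd_ge0 psdH); exact: (herm_domB hrmH).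
  - move=> p; apply: le_trans (qformB_le psdH (fh p.1) (sh p.1) (fh p.2)) _.
    rewrite lerD2l ler_pM2l//.
    apply: le_trans (qformB_le psdH (sh p.1) (sh p.2) (fh p.2)) _.
    by rewrite [qform _ (s p.2 - f p.2)](qform_distC hrmH).
  rewrite [X in _ --> X](_ : 0 = 2 * 0 + 2 * (2 * 0 + 2 * 0)); last by ring.
  have l1 : qform (shift mu h a) (f p.1 - s p.1) @[p --> (\oo, \oo)] --> (0 : R).
    exact: (cvg_comp _ _ cvg_fst fsH).
  have l2 : qform (shift mu h a) (f p.2 - s p.2) @[p --> (\oo, \oo)] --> (0 : R).
    exact: (cvg_comp _ _ cvg_snd fsH).
  apply: cvgD; (apply: cvgM; first exact: cvg_cst) => //.
  by apply: cvgD; apply: cvgM => //; exact: cvg_cst.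
have hu : fdom h u by exists f.
split=> //; have fuH := closure_energy_cvg uf.
apply: (@cvg0_le _ _ _ _ _ (fun n => 2 * qform (shift mu h a) (f n - s n) +
  2 * qform (shift mu h a) (f n - u))).
- by move=> n; apply: (psd_ge0 psdH); exact: (herm_domB hrmH).
- move=> n; apply: le_trans (qformB_le psdH (sh n) (fh n) hu) _.
  by rewrite [qform _ (s n - f n)](qform_distC hrmH).
rewrite [X in _ --> X](_ : 0 = 2 * 0 + 2 * 0); last by ring.
by apply: cvgD; apply: cvgM => //; exact: cvg_cst.
Qed.

End ClosureOfForm.
End Closure.

(** * The form of a multiplication operator *)

Definition mult_form {R : realType} {X : countType} (mu W : X -> R) : sform R X :=
  {| fdom := ell2 mu `&` ell2 (fun x => mu x * W x);
     fval := inner (fun x => mu x * W x) |}.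

Section Multiplication.
Context {R : realType} {X : countType} {mu W : X -> R}.
Hypothesis mu0 : forall x, 0 < mu x.
Hypothesis W0 : forall x, 0 <= W x.
Implicit Types (u v f : X -> R[i]) (s t : nat -> X -> R[i]).
Let mu0' x : 0 <= mu x := ltW (mu0 x).
Local Notation w := (fun x => mu x * W x).
Let w0 x : 0 <= w x := mulr_ge0 (mu0' x) (W0 x).
Local Notation N := (qform (inner mu)).
Let psdN := inner_psd mu0'.
Let hrmN := psd_herm psdN.
Let psdW := inner_psd w0.
Let hrmW := psd_herm psdW.

Lemma mult_form_semibounded : semibounded_form mu (mult_form mu W).
Proof.
split; first by move=> u [].
- split.
  + by split; [exact: (herm_dom0 hrmN)|exact: (herm_dom0 hrmW)].
  + move=> a u v [uE uW] [vE vW].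
    by split; [exact: (herm_domP hrmN)|exact: (herm_domP hrmW)].
  + by move=> a u v z [_ uW] [_ vW] [_ zW]; exact: (herm_linear hrmW).
  + by move=> u v [_ uW] [_ vW]; exact: (herm_sym hrmW).
- by exists 0 => u [_ uW]; rewrite mul0r (psd_ge0 psdW).
Qed.

Lemma mult_form_coercive : coercive mu (mult_form mu W) 1.
Proof.
by move=> u [_ uW]; rewrite qform_shift mul1r lerDr (psd_ge0 psdW).
Qed.

Lemma mult_form_closed : closed_form mu (mult_form mu W).
Proof.
have qsb := mult_form_semibounded; have qa := mult_form_coercive.
apply: (closed_formI mu0 qsb qa).
  move=> u uE e e0; have [v vc uv] := Cc_dense mu0' uE e0.
  by exists v => //; exact: (conj (Cc_ell2 vc) (Cc_ell2 vc)).
move=> s u /(form_cvgE mu0 _ _ qsb qa)[uE sq sN sQ].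
have sE n : ell2 mu (s n) := (sq n).1.
have sW n : ell2 w (s n) := (sq n).2.
have pt x : s n x @[n --> \oo] --> (u x : R[i]^o).
  have h : (s n - u) x @[n --> \oo] --> (0 : R[i]^o).
    apply: (@ell2_cvg_point _ _ _ mu0 _ _ _ (fun n => s n - u)) => // n.
    exact: (herm_domB hrmN).
  have -> : (fun n => s n x) = (fun n => (s n - u) x + u x).
    by apply/funext => n; rewrite -[LHS](subrK (u x)).
  rewrite -[X in _ --> X]add0r.
  apply: (@cvgD _ R[i]^o _ _ _ (fun n => (s n - u) x)); first exact: h.
  exact: cvg_cst.
have [|uW uc] := ell2_closed w0 sW pt.
  apply: cvg0_le sQ => p; first by apply: (psd_ge0 psdW); exact: (herm_domB hrmW).
  by rewrite qform_shift mul1r lerDl (psd_ge0 psdN)//; exact: (herm_domB hrmN).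
split=> //.
have -> : (fun n => qform (shift mu (mult_form mu W) 1) (s n - u)) =
    (fun n => qform (inner w) (s n - u) + N (s n - u)).
  by apply/funext => n; rewrite qform_shift mul1r.
by rewrite -[X in _ --> X](addr0 (0 : R)); exact: cvgD.
Qed.

Lemma inner_mult u v : inner w u v = inner mu (fun x => (W x)%:C * u x) v.
Proof. by congr csum; apply/funext => x; rewrite rmorphM /=; ring. Qed.

(** Testing against the indicator of a point identifies the operator pointwise.
    Conversely [W |u|^2 <= |u|^2 + |W u|^2] puts the domain of multiplication
    inside that of the form. *)
Lemma mult_form_operator :
  form_operator mu (mult_form mu W) = mult_operator mu W.
Proof.
apply/seteqP; split=> -[u f] /= [].
  move=> [uE uW] fE uf; split=> //; apply/funext => x.
  have dc := @Cc_delta R X x.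
  have : inner w u _ = inner mu f _ := uf _ (conj (Cc_ell2 dc) (Cc_ell2 dc)).
  rewrite inner_mult !inner_delta//= => /mulfI -> //.
  by rewrite eq_complex /= eqxx andbT gt_eqF.
move=> uE fE /= fu; split=> //=; last first.
  by move=> v _; rewrite -[LHS]/(inner w u v) inner_mult fu.
split=> //; move: (uE) (fE); rewrite !ell2E fu => uS fS.
apply: summable_le (summD uS fS) => x.
have m0 := mu0' x; have nn := wsq_ge0 mu0' u x.
have nn' := wsq_ge0 mu0' (fun x => (W x)%:C * u x) x.
rewrite (ger0_norm (wsq_ge0 w0 u x)) ger0_norm ?addr_ge0//.
rewrite -mulrDr -mulrA ler_wpM2l// !cReImE /=; have := W0 x.
move: (W x) (complex.Re (u x)) (complex.Im (u x)) => c y z c0.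
rewrite [leRHS](_ : _ = (1 + c ^+ 2) * (y ^+ 2 + z ^+ 2)); last by ring.
have := sqr_ge0 (c - 1) => h; rewrite ler_wpM2r ?addr_ge0 ?sqr_ge0//; nra.
Qed.

End Multiplication.

(** * The form of a Schrodinger operator *)

Definition degree {R : realType} {X : countType} (b : X -> X -> R) (x : X) : R :=
  rsum (b x).

Section SchrodingerForm.
Context {R : realType} {X : countType} {b : X -> X -> R} {mu : X -> R}.
Hypothesis hG : weighted_graph b mu.
Hypothesis hFC : finiteness_condition b mu.
Implicit Types (u v f : X -> R[i]) (V : X -> R) (S : seq X).
Let mu0 := wg_weight_gt0 hG.
Let mu0' x : 0 <= mu x := ltW (mu0 x).
Local Notation N := (qform (inner mu)).
Let psdN := inner_psd mu0'.
Let hrmN := psd_herm psdN.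
Local Notation sq z := (complex.Re z ^+ 2 + complex.Im z ^+ 2).

Definition supported S u := forall x, x \notin S -> u x = 0.

Lemma Cc_supported u v w : Cc u -> Cc v -> Cc w -> exists S,
  [/\ uniq S, supported S u, supported S v & supported S w].
Proof.
move=> /CcP[r1 _ h1] /CcP[r2 _ h2] /CcP[r3 _ h3].
exists (undup (r1 ++ r2 ++ r3)); split; first exact: undup_uniq.
- by move=> x; rewrite mem_undup !mem_cat => /norP[/h1].
- by move=> x; rewrite mem_undup !mem_cat => /norP[_ /norP[/h2]].
- by move=> x; rewrite mem_undup !mem_cat => /norP[_ /norP[_ /h3]].
Qed.

Lemma schrodingerE V S u x : uniq S -> supported S u ->
  schrodinger b mu V u x = ((mu x)^-1 * degree b x + V x)%:C * u x -
    ((mu x)^-1)%:C * \sum_(y <- S) (b x y)%:C * u y.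
Proof.
move=> SU Su; rewrite /schrodinger.
have bs : csummable (fun y => (b x y)%:C * u x).
  have h := wg_summable hG x; split.
    have -> : (fun y => complex.Re ((b x y)%:C * u x)) =
        (fun y => complex.Re (u x) * b x y).
      by apply/funext => y; rewrite cReMr mulrC.
    exact: summZ.
  have -> : (fun y => complex.Im ((b x y)%:C * u x)) =
      (fun y => complex.Im (u x) * b x y).
    by apply/funext => y; rewrite cImM /= mul0r addr0 mulrC.
  exact: summZ.
have us : csummable (fun y => - 1 * ((b x y)%:C * u y)).
  by split; apply: (@rsum_finite _ _ _ S SU _).1 => y /Su ->; rewrite !mulr0.
have -> : csum (fun y => (b x y)%:C * (u x - u y)) =
    csum (fun y => (b x y)%:C * u x) + csum (fun y => - 1 * ((b x y)%:C * u y)).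
  by rewrite -csumD//; congr csum; apply/funext => y; ring.
rewrite (@csum_finite _ _ (fun y => - 1 * ((b x y)%:C * u y)) S)//; last first.
  by move=> y /Su ->; rewrite !mulr0.
rewrite -mulr_sumr.
have -> : csum (fun y => (b x y)%:C * u x) = (degree b x)%:C * u x.
  have cb : csummable (fun y => (b x y)%:C).
    by split; [exact: (wg_summable hG)|apply: (@rsum_finite _ _ _ [::] isT _).1].
  have -> : (fun y => (b x y)%:C * u x) = (fun y => u x * (b x y)%:C).
    by apply/funext => y; rewrite mulrC.
  rewrite csumZ// mulrC; congr (_ * _); rewrite /csum /degree /=.
  by rewrite rsum0.
by rewrite rmorphD rmorphM /=; ring.
Qed.

(** On functions supported in a finite set [S] the form is a finite expression:
    the infinite sums enter only through the degree. *)
Lemma schrodinger_formE V S u v : uniq S -> supported S u -> supported S v ->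
  fval (schrodinger_form b mu V) u v = \sum_(x <- S)
    ((degree b x + mu x * V x)%:C * u x - \sum_(y <- S) (b x y)%:C * u y) * (v x)^*.
Proof.
move=> SU Su Sv; rewrite /= (inner_finite _ SU Sv); apply: eq_bigr => x _.
rewrite (schrodingerE _ _ SU Su).
have mx : (mu x)%:C != 0 by rewrite eq_complex /= eqxx andbT gt_eqF.
rewrite fmorphV rmorphD [in RHS]rmorphD !rmorphM fmorphV /=.
by congr (_ * _); field.
Qed.

Lemma schrodinger_herm V : herm_form (@Cc R X)
  (fval (schrodinger_form b mu V) : (X -> R[i]) -> (X -> R[i]) -> R[i]).
Proof.
split.
- by apply/CcP; exists [::].
- by move=> a u v; exact: Cc_lin.
- move=> a u v w uc vc wc; have [S [SU Su Sv Sw]] := Cc_supported uc vc wc.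
  have Suv : supported S (a *: u + v).
    by move=> x xS; rewrite [LHS](_ : _ = a * u x + v x)// Su// Sv// mulr0 addr0.
  rewrite !(schrodinger_formE _ SU)// mulr_sumr -big_split /=; apply: eq_bigr => x _.
  have -> : (a *: u + v) x = a * u x + v x by [].
  have -> : \sum_(y <- S) (b x y)%:C * (a *: u + v) y =
      a * (\sum_(y <- S) (b x y)%:C * u y) + \sum_(y <- S) (b x y)%:C * v y.
    rewrite mulr_sumr -big_split /=; apply: eq_bigr => y _.
    by rewrite [(a *: u + v) y](_ : _ = a * u y + v y)//; ring.
  ring.
- move=> u v uc vc; have [S [SU Su Sv _]] := Cc_supported uc vc vc.
  rewrite !(schrodinger_formE _ SU)// rmorph_sum /=.
  under eq_bigr do rewrite mulrBl mulr_suml.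
  under [RHS]eq_bigr do rewrite rmorphM rmorphB rmorphM rmorph_sum /= mulrBl mulr_suml.
  rewrite !sumrB; congr (_ - _).
    apply: eq_bigr => x _; apply: complex_eq; rewrite !cReImE /=; ring.
  rewrite exchange_big /=; apply: eq_bigr => x _; apply: eq_bigr => y _.
  rewrite (wg_sym hG); apply: complex_eq; rewrite !cReImE /=; ring.
Qed.

(** The finiteness condition enters here: outside the support of [u],
    [schrodinger b mu V u] is a finite combination of the functions
    [b y x / mu x] of [x]. *)
Lemma schrodinger_ell2 V u : Cc u -> ell2 mu (schrodinger b mu V u).
Proof.
move=> uc; have [S [SU Su _ _]] := Cc_supported uc uc uc.
pose d : X -> R[i] := fun x => ((mu x)^-1 * degree b x + V x)%:C * u x.
have dE : ell2 mu d.
  by apply: Cc_ell2; apply/CcP; exists S => // x xS; rewrite /d Su// mulr0.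
pose g (r : seq X) : X -> R[i] := \sum_(y <- r) (- u y) *: (fun x => (b y x / mu x)%:C).
have gE r : ell2 mu (g r).
  rewrite /g; elim: r => [|y r IH]; first by rewrite big_nil; exact: (herm_dom0 hrmN).
  by rewrite big_cons; apply: (herm_domP hrmN) => //; exact: hFC.
suff -> : schrodinger b mu V u = d + g S by exact: (herm_domD hrmN).
apply/funext => x; rewrite (schrodingerE _ _ SU Su) mulr_sumr.
rewrite [RHS](_ : _ = d x + g S x)// /g fct_sumE -sumrN; congr (_ + _).
apply: eq_bigr => y _.
rewrite [RHS](_ : _ = - u y * (b y x / mu x)%:C)// (wg_sym hG) rmorphM /=.
by ring.
Qed.

Lemma schrodinger_closable V u : Cc u -> exists c : R, forall v, Cc v ->
  complex.Re (fval (schrodinger_form b mu V) u v) ^+ 2 <= c * N v.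
Proof.
move=> uc; exists (N (schrodinger b mu V u)) => v vc.
by apply: (psd_cauchy_schwarz psdN); [exact: schrodinger_ell2|exact: Cc_ell2].
Qed.

Lemma schrodinger_semibounded V (C : R) :
  (forall u, Cc u ->
    (C * ell2_norm mu u ^+ 2)%:C <= inner mu (schrodinger b mu V u) u) ->
  semibounded_form mu (schrodinger_form b mu V).
Proof.
move=> hC; split; [by move=> u; exact: Cc_ell2|exact: schrodinger_herm|].
exists C => u uc; have := hC u uc.
by rewrite (ell2_normX mu0') ?lecE => [/andP[]//|]; exact: Cc_ell2.
Qed.

Lemma schrodinger_formD (V V1 V2 : X -> R) u v : (forall x, V x = V1 x + V2 x) ->
  Cc u -> Cc v -> fval (schrodinger_form b mu V) u v =
    fval (schrodinger_form b mu V1) u v + inner (fun x => mu x * V2 x) u v.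
Proof.
move=> VE uc vc; have [S [SU Su Sv _]] := Cc_supported uc vc vc.
rewrite !(schrodinger_formE _ SU)// (inner_finite _ SU Sv) -big_split /=.
by apply: eq_bigr => x _; rewrite VE mulrDr addrA rmorphD /=; ring.
Qed.

End SchrodingerForm.

(** * Truncation *)

Section Truncation.
Context {R : realType}.
Implicit Types z w : R[i].
Local Notation normc := (@ComplexField.Normc.normc R).
Local Notation sq z := (complex.Re z ^+ 2 + complex.Im z ^+ 2).

(** The projection of [z] onto the disc of radius [|w|]; at [z = 0] the inverse of
    zero is harmless since it is multiplied by [z]. *)
Definition trunc z w : R[i] := z * (Num.min (normc z) (normc w) / normc z)%:C.

Lemma normc_ge0 z : 0 <= normc z.
Proof. by case: z => x y /=; exact: sqrtr_ge0. Qed.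

(** [trunc] as a contraction factor, which avoids the division by zero. *)
Lemma trunc_factor z w : exists t : R, [/\ 0 <= t <= 1,
  trunc z w = z * t%:C & t * normc z = Num.min (normc z) (normc w)].
Proof.
have [z0|z0] := eqVneq (normc z) 0.
  exists 0; split; first by rewrite lexx ler01.
    by rewrite /trunc z0 invr0 mulr0.
  by rewrite z0 mulr0 min_l// normc_ge0.
have zp : 0 < normc z by rewrite lt_def z0 normc_ge0.
exists (Num.min (normc z) (normc w) / normc z); split=> //; last by rewrite mulfVK.
by rewrite divr_ge0 ?le_min ?normc_ge0//= ler_pdivrMr// mul1r ge_min lexx.
Qed.

Lemma normc_trunc z w : normc (trunc z w) = Num.min (normc z) (normc w).
Proof.
have [t [/andP[t0 _] -> tE]] := trunc_factor z w.
rewrite ComplexField.Normc.normcM mulrC -tE; congr (_ * _).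
by rewrite /= expr0n addr0 sqrtr_sqr ger0_norm.
Qed.

Lemma Re_mul_conj_le z w : complex.Re (z * w^*) <= normc z * normc w.
Proof.
rewrite -[X in _ <= X]ger0_norm ?mulr_ge0 ?normc_ge0// -sqrtr_sqr exprMn !sqr_normcE.
apply: le_trans (ler_norm _) _; rewrite -sqrtr_sqr ler_wsqrtr//.
rewrite !cReImE mulrN opprK.
move: (complex.Re z) (complex.Im z) (complex.Re w) (complex.Im w) => a b c d.
rewrite -subr_ge0.
by rewrite (_ : _ - _ = (a * d - b * c) ^+ 2) ?sqr_ge0//; ring.
Qed.

(** Truncation scales [Re (z1 conj z2)], which is at most [|z1| |z2|], by a factor
    between 0 and 1; this reduces the claim to the rearrangement inequality
    [|z1| |z2| + |w1| |w2| <= min min + max max] for the moduli. *)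
Lemma trunc_max_correlation z1 z2 w1 w2 :
  complex.Re (z1 * z2^*) + complex.Re (w1 * w2^*) <=
  complex.Re (trunc z1 w1 * (trunc z2 w2)^*) +
  Num.max (normc z1) (normc w1) * Num.max (normc z2) (normc w2).
Proof.
have [t1 [/andP[t10 t11] -> m1]] := trunc_factor z1 w1.
have [t2 [/andP[t20 t21] -> m2]] := trunc_factor z2 w2.
have -> : complex.Re (z1 * t1%:C * (z2 * t2%:C)^*) = t1 * t2 * complex.Re (z1 * z2^*).
  by rewrite !cReImE /=; ring.
have hz := Re_mul_conj_le z1 z2; have hw := Re_mul_conj_le w1 w2.
have t12 : 0 <= 1 - t1 * t2 by rewrite subr_ge0 mulr_ile1.
have h1 := ler_wpM2l t12 hz.
have mm : t1 * t2 * (normc z1 * normc z2) =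
  Num.min (normc z1) (normc w1) * Num.min (normc z2) (normc w2).
  by rewrite -m1 -m2; ring.
move: hw h1 mm; move: (complex.Re (z1 * _)) (complex.Re (w1 * _)) => P Q.
move: (normc z1) (normc z2) (normc w1) (normc w2) => r1 r2 s1 s2 hw h1 mm.
suff : r1 * r2 + s1 * s2 <=
   Num.min r1 s1 * Num.min r2 s2 + Num.max r1 s1 * Num.max r2 s2.
  by rewrite -mm; lra.
by rewrite /Num.min /Num.max; case: ltP => ?; case: ltP => ?; nra.
Qed.

Lemma sq_trunc_max z w :
  sq (trunc z w) + Num.max (normc z) (normc w) ^+ 2 = sq z + sq w.
Proof.
rewrite -!sqr_normcE normc_trunc /Num.min /Num.max.
by case: ltP => _; rewrite // addrC.
Qed.

Lemma trunc_le z w : sq (trunc z w) <= sq z.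
Proof.
rewrite -!sqr_normcE normc_trunc ler_pXn2r ?nnegrE ?le_min ?normc_ge0//.
by rewrite ge_min lexx.
Qed.

Lemma trunc_dist z w : sq (trunc z w - z) <= sq (z - w).
Proof.
have [t [/andP[t0 t1] -> tE]] := trunc_factor z w.
have -> : sq (z * t%:C - z) = (normc z - t * normc z) ^+ 2.
  rewrite !cReImE /= -[normc z]mul1r mulrA mulr1 -mulrBl exprMn sqr_normcE.
  by ring.
have hw := Re_mul_conj_le z w.
have -> : sq (z - w) = sq z + sq w - 2 * complex.Re (z * w^*).
  by rewrite !cReImE; ring.
rewrite tE -!sqr_normcE; have := sqr_ge0 (normc z - normc w).
have := normc_ge0 z; have := normc_ge0 w; move: hw.
move: (normc z) (normc w) (complex.Re _) => r s P.
by rewrite /Num.min; case: ltP => ? ? ? ? ?; nra.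
Qed.

Lemma trunc0 z : trunc z 0 = 0.
Proof.
by rewrite /trunc ComplexField.Normc.normc0 min_r ?normc_ge0// mul0r rmorph0 mulr0.
Qed.

Lemma trunc0l w : trunc 0 w = 0.
Proof. by rewrite /trunc mul0r. Qed.

End Truncation.

Section InnerMonotone.
Context {R : realType} {X : countType}.
Implicit Types (u v f g : X -> R[i]) (w : X -> R).
Local Notation sq z := (complex.Re z ^+ 2 + complex.Im z ^+ 2).

Lemma qform_inner_le w w' f g : (forall x, 0 <= w x) -> (forall x, 0 <= w' x) ->
  ell2 w f -> ell2 w' g -> (forall x, w x * sq (f x) <= w' x * sq (g x)) ->
  qform (inner w) f <= qform (inner w') g.
Proof.
by move=> w0 w'0; rewrite !ell2E => fE gE fg; rewrite !qform_inner le_rsum.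
Qed.

End InnerMonotone.

Section Core.
Context {R : realType} {X : countType} {b : X -> X -> R} {mu V V1 V2 : X -> R}.
Hypothesis hG : weighted_graph b mu.
Hypothesis hV : forall x, V x = V1 x + V2 x.
Hypothesis hV2 : forall x, 0 <= V2 x.
Implicit Types (u v f g : X -> R[i]).
Let mu0 := wg_weight_gt0 hG.
Let mu0' x : 0 <= mu x := ltW (mu0 x).
Local Notation N := (qform (inner mu)).
Let psdN := inner_psd mu0'.
Let hrmN := psd_herm psdN.
Local Notation w := (fun x => mu x * V2 x).
Let w0 x : 0 <= w x := mulr_ge0 (mu0' x) (hV2 x).
Let psdW := inner_psd w0.
Let hrmW := psd_herm psdW.
Local Notation sq z := (complex.Re z ^+ 2 + complex.Im z ^+ 2).
Local Notation normc := (@ComplexField.Normc.normc R).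
Local Notation q1 := (schrodinger_form b mu V1).
Local Notation q := (schrodinger_form b mu V).

Definition ftrunc f g : X -> R[i] := fun x => trunc (f x) (g x).
Definition fmax f g : X -> R[i] := fun x => (Num.max (normc (f x)) (normc (g x)))%:C.

Lemma schrodinger_energyE (W : X -> R) S u : uniq S -> supported S u ->
  qform (fval (schrodinger_form b mu W)) u =
  \sum_(x <- S) (degree b x + mu x * W x) * sq (u x) -
  \sum_(x <- S) \sum_(y <- S) b x y * complex.Re (u y * (u x)^*).
Proof.
move=> SU Su; rewrite /qform (schrodinger_formE hG _ SU)//.
rewrite (big_morph _ cReD (erefl : complex.Re (0 : R[i]) = 0)) -sumrB.
apply: eq_bigr => x _; rewrite mulrBl mulr_suml cReD cReN; congr (_ - _).
  by rewrite -mulrA cReMr; congr (_ * _); rewrite !cReImE; ring.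
rewrite (big_morph _ cReD (erefl : complex.Re (0 : R[i]) = 0)).
by apply: eq_bigr => y _; rewrite -mulrA cReMr.
Qed.

Lemma schrodinger_energy_shift (W : X -> R) (a : R) u : Cc u ->
  qform (fval (schrodinger_form b mu (fun x => W x + a))) u =
  qform (shift mu (schrodinger_form b mu W) a) u.
Proof.
move=> uc; have [S [SU Su _ _]] := Cc_supported uc uc uc.
have E1 := schrodinger_energyE (fun x => W x + a) SU Su.
have E2 := schrodinger_energyE W SU Su.
have E3 : N u = \sum_(x <- S) mu x * sq (u x).
  rewrite qform_inner; apply: (@rsum_finite _ _ _ S SU _).2 => x /Su ->.
  by rewrite expr0n /= addr0 mulr0.
rewrite qform_shift E1 E2 E3 mulr_sumr addrAC -big_split /=; congr (_ - _).
by apply: eq_bigr => x _; ring.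
Qed.

(** A lattice inequality of Beurling-Deny type, for potentials of any sign. The
    diagonal terms agree because [min^2 + max^2] is the sum of the squares; the
    off-diagonal terms carry the factor [- b <= 0] and obey
    [trunc_max_correlation]. *)
Lemma truncation_energy (W : X -> R) f g : Cc f -> Cc g ->
  [/\ Cc (ftrunc f g), Cc (fmax f g) &
  qform (fval (schrodinger_form b mu W)) (ftrunc f g) +
  qform (fval (schrodinger_form b mu W)) (fmax f g) <=
  qform (fval (schrodinger_form b mu W)) f +
  qform (fval (schrodinger_form b mu W)) g].
Proof.
move=> fc gc; have [S [SU Sf Sg _]] := Cc_supported fc gc gc.
have St : supported S (ftrunc f g) by move=> x /Sf fx; rewrite /ftrunc fx trunc0l.
have Sm : supported S (fmax f g).
  move=> x xS; rewrite /fmax Sf// Sg// ComplexField.Normc.normc0 maxxx.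
  by rewrite rmorph0.
split; [by apply/CcP; exists S|by apply/CcP; exists S|].
rewrite !(schrodinger_energyE _ SU)// addrACA -opprD [leRHS]addrACA -opprD.
rewrite -!big_split /= lerB//.
  rewrite le_eqVlt; apply/orP; left; apply/eqP; apply: eq_bigr => x _.
  rewrite -!mulrDr; congr (_ * _); rewrite -sq_trunc_max /=.
  by rewrite expr0n /= addr0.
apply: ler_sum => x _; rewrite -!big_split; apply: ler_sum => y _ /=.
rewrite -!mulrDr ler_wpM2l//; first exact: (wg_ge0 hG).
apply: le_trans (trunc_max_correlation (f y) (f x) (g y) (g x)) _.
by rewrite lerD2l mul0r subr0.
Qed.

(** By [bounded_energy_form_cvg] it is enough to approximate [u] in l^2 by finitely
    supported functions of bounded energy for the total potential. Let [f] and [g]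
    be finitely supported and close to [u], and truncate [g] to the modulus of
    [f]. The energy for [V1] is bounded by those of [f] and [g], since the energy
    of the maximum is bounded below. The truncation is supported in the support
    of [f], so once [f] is fixed the energy for [V2] is controlled by choosing [g]
    close enough to [u]. *)
Lemma form_sum_dom_closure u (a : R) :
  semibounded_form mu q1 -> coercive mu q1 a ->
  semibounded_form mu q -> coercive mu q a ->
  (exists s, form_cvg mu q1 s u) -> ell2 w u ->
  exists s, form_cvg mu q s u.
Proof.
move=> q1sb q1a qsb qa [s su] uW.
have psd1 := shift_psd mu0 q1sb q1a.
have [uE sc sN sQ] := (form_cvgE mu0 _ _ q1sb q1a).1 su.
have [c hc] := psd_cauchy_bounded psd1 sc sQ.
have Qs n : qform (shift mu q1 a) (s n) <= c ^+ 2.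
  rewrite -[leLHS]sqr_sqrtr ?(psd_ge0 psd1)// ler_pXn2r ?nnegrE ?sqrtr_ge0//.
  exact: le_trans (sqrtr_ge0 _) (hc n).
have sE n : ell2 mu (s n) by exact: (Cc_ell2 (sc n)).
apply: (bounded_energy_form_cvg mu0 (M := 2 * c ^+ 2 + (2 + 2 * qform (inner w) u))
  qsb qa uE) => e e0.
have e16 : 0 < e / 16 by rewrite divr_gt0.
have [n1 hn1] := (cvg0_seqP _).1 sN _ e16.
pose f := s n1.
have [r rU rf] := (CcP f).1 (sc n1).
(* A bound for [V2] on the support of [f]; [g] is chosen so close to [u] that even
   [k + 1] times the squared distance is at most 1. *)
pose k := \sum_(x <- r) V2 x.
have k0 : 0 <= k by rewrite sumr_ge0.
have kd : 0 < (k + 1)^-1 by rewrite invr_gt0 ltr_wpDl.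
have [n2 hn2] := (cvg0_seqP _).1 sN _ kd.
pose m := maxn n1 n2; pose g := s m.
have fu : N (f - u) <= e / 16.
  by apply: ltW; apply: le_lt_trans (hn1 n1 (leqnn _)); exact: ler_norm.
have gu : N (g - u) <= e / 16.
  by apply: ltW; apply: le_lt_trans (hn1 m (leq_maxl _ _)); exact: ler_norm.
have gu' : N (g - u) <= (k + 1)^-1.
  by apply: ltW; apply: le_lt_trans (hn2 m (leq_maxr _ _)); exact: ler_norm.
have fc : Cc f by exact: sc.
have gc : Cc g by exact: sc.
have fE : ell2 mu f := sE _; have gE : ell2 mu g := sE _.
have [vc wc en] := truncation_energy (fun x => V1 x + a) gc fc.
have VaE h : Cc h -> qform (fval (schrodinger_form b mu (fun x => V1 x + a))) h =
    qform (shift mu q1 a) h by exact: schrodinger_energy_shift.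
rewrite (VaE _ vc) (VaE _ wc) (VaE _ gc) (VaE _ fc) in en.
set v := ftrunc g f in vc wc en *.
have vE : ell2 mu v := Cc_ell2 vc.
have gmE : ell2 mu (g - f) by exact: (herm_domB hrmN).
exists v; split => //.
- have h1 : N (v - g) <= N (g - f).
    apply: qform_inner_le => //; first exact: (herm_domB hrmN).
    by move=> x; rewrite ler_wpM2l//; exact: trunc_dist.
  have h2 := qformB_le psdN vE gE uE.
  have h3 := qformB_le psdN gE uE fE.
  rewrite [N (u - f)](qform_distC hrmN)// in h3.
  lra.
have -> : qform (shift mu q a) v = qform (shift mu q1 a) v + qform (inner w) v.
  rewrite !qform_shift {1}/qform (schrodinger_formD hG hV)// cReD.
  by rewrite -/(qform (inner w) v) -/(qform (fval q1) v); ring.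
apply: lerD.
  have := psd_ge0 psd1 wc; have := Qs n1; have := Qs m; rewrite -/f -/g; lra.
pose on (h : X -> R[i]) : X -> R[i] := fun x => if x \in r then h x else 0.
have onc h : Cc (on h) by apply/CcP; exists r => // x /negbTE xr; rewrite /on xr.
have onW h : ell2 w (on h) := Cc_ell2 (onc h).
have h1 : qform (inner w) v <= qform (inner w) (on g).
  apply: qform_inner_le => //; first exact: Cc_ell2.
  move=> x; rewrite ler_wpM2l// /on /v /ftrunc; case: ifPn => [_|/rf ->].
    exact: trunc_le.
  by rewrite trunc0.
have h2 := qformD_le psdW (onW (g - u)) (onW u).
have -> : 2 + 2 * qform (inner w) u = 2 * 1 + 2 * qform (inner w) u by rewrite mulr1.
apply: le_trans h1 _; have -> : on g = on (g - u) + on u.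
  apply/funext => x; rewrite [RHS](_ : _ = on (g - u) x + on u x)// /on.
  by case: ifP => _; rewrite ?addr0// [RHS](_ : _ = g x - u x + u x)// subrK.
apply: le_trans h2 _; apply: lerD; rewrite ler_pM2l//; last first.
  apply: qform_inner_le => // x; rewrite /on; case: ifP => // _.
  by rewrite expr0n /= addr0 mulr0; exact: (wsq_ge0 w0 u x).
have kmu0 x : 0 <= (k + 1) * mu x by rewrite mulr_ge0// addr_ge0.
have guE : ell2 mu (g - u) by exact: (herm_domB hrmN).
have E : qform (inner (fun x => (k + 1) * mu x)) (g - u) = (k + 1) * N (g - u).
  rewrite !qform_inner -rsumZ; last by move: guE; rewrite ell2E.
  by congr rsum; apply/funext => x; ring.
have guE' : ell2 (fun x => (k + 1) * mu x) (g - u).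
  move: guE; rewrite !ell2E => /(summZ (k + 1)); congr (is_true (summable _ _)).
  by apply/funext => x /=; rewrite mulrA.
apply: (@le_trans _ _ ((k + 1) * N (g - u))); last first.
  by rewrite -ler_pdivlMl ?mulr1// ltr_wpDl.
rewrite -E; apply: qform_inner_le => // x; rewrite /on; case: ifPn => xr; last first.
  by rewrite expr0n /= addr0 mulr0; exact: (wsq_ge0 kmu0 (g - u) x).
rewrite ler_wpM2r ?addr_ge0 ?sqr_ge0// mulrC ler_wpM2r//.
rewrite /k (bigD1_seq x)//= -addrA lerDl addr_ge0// sumr_ge0//.
Qed.

End Core.

(** * The form sum *)

Section FormSum.
Context {R : realType} {X : countType} {b : X -> X -> R} {mu V V1 V2 : X -> R}.
Hypothesis hG : weighted_graph b mu.
Hypothesis hFC : finiteness_condition b mu.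
Hypothesis hV : forall x, V x = V1 x + V2 x.
Hypothesis hV2 : forall x, 0 <= V2 x.
Hypothesis q1sb : semibounded_form mu (schrodinger_form b mu V1).
Implicit Types (u v : X -> R[i]) (s t : nat -> X -> R[i]).
Let mu0 := wg_weight_gt0 hG.
Let mu0' x : 0 <= mu x := ltW (mu0 x).
Local Notation N := (qform (inner mu)).
Let psdN := inner_psd mu0'.
Let hrmN := psd_herm psdN.
Local Notation w := (fun x => mu x * V2 x).
Let w0 x : 0 <= w x := mulr_ge0 (mu0' x) (hV2 x).
Let psdW := inner_psd w0.
Let hrmW := psd_herm psdW.
Local Notation q1 := (schrodinger_form b mu V1).
Local Notation q2 := (mult_form mu V2).
Local Notation q := (schrodinger_form b mu V).
Local Notation h1 := (form_closure mu q1).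
Local Notation h := (form_closure mu q).

Lemma schrodinger_energyD a u : Cc u ->
  qform (shift mu q a) u = qform (shift mu q1 a) u + qform (inner w) u.
Proof.
move=> uc; rewrite !qform_shift {1}/qform (schrodinger_formD hG hV uc uc) cReD.
by rewrite -/(qform (inner w) u) -/(qform (fval q1) u) addrAC.
Qed.

Lemma potential_semibounded : semibounded_form mu q.
Proof.
have [_ _ [c hc]] := q1sb.
split; [by move=> u; exact: Cc_ell2|exact: schrodinger_herm hG V|].
exists c => u uc; have := schrodinger_energyD 0 uc.
rewrite !qform_shift !mul0r !addr0 => ->.
by apply: ler_wpDr (hc u uc); apply: (psd_ge0 psdW); exact: Cc_ell2.
Qed.

Lemma potential_coercive a : coercive mu q1 a -> coercive mu q a.
Proof.
move=> q1a u uc; rewrite schrodinger_energyD//.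
by apply: ler_wpDr (q1a u uc); apply: (psd_ge0 psdW); exact: Cc_ell2.
Qed.

Lemma schrodinger_closure_closed (W : X -> R) :
  semibounded_form mu (schrodinger_form b mu W) ->
  closed_form mu (form_closure mu (schrodinger_form b mu W)).
Proof.
move=> sb; have [a ha] := semibounded_coercive mu0 sb.
apply: (closure_closed mu0 sb (ha a (lexx a))).
  by move=> u; exact: (schrodinger_closable hG hFC).
by move=> u uE e; exact: (Cc_dense mu0' uE).
Qed.

(** The energy for [V] is the sum of two energies that are each nonnegative after
    the shift, so being Cauchy for the sum is being Cauchy for both. *)
Lemma form_cvg_split a s u : coercive mu q1 a -> form_cvg mu q s u ->
  form_cvg mu q1 s u /\ form_cvg mu q2 s u.
Proof.
move=> q1a; have qsb := potential_semibounded; have qa := potential_coercive q1a.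
have q2sb := @mult_form_semibounded _ _ _ _ mu0 hV2.
have q2a := @mult_form_coercive _ _ _ _ mu0 hV2.
have psd1 := shift_psd mu0 q1sb q1a; have psd2 := shift_psd mu0 q2sb q2a.
have hC := psd_herm (shift_psd mu0 qsb qa).
move=> /(form_cvgE mu0 _ _ qsb qa)[uE sc sN sQ].
have dc (p : nat * nat) : Cc (s p.1 - s p.2) by exact: (herm_domB hC (sc _) (sc _)).
have dE p : ell2 mu (s p.1 - s p.2) := Cc_ell2 (dc p).
have dW p : ell2 w (s p.1 - s p.2) := Cc_ell2 (dc p).
split.
  apply/(form_cvgE mu0 _ _ q1sb q1a).
  split; [exact: uE|exact: sc|exact: sN|]; apply: cvg0_le sQ => p.
    by apply: (psd_ge0 psd1); exact: dc.
  by rewrite (schrodinger_energyD _ (dc p)) lerDl (psd_ge0 psdW).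
apply/(form_cvgE mu0 _ _ q2sb q2a); split=> //.
  by move=> n; split; exact: (Cc_ell2 (sc n)).
have h2 : 2 * qform (shift mu q a) (s p.1 - s p.2) @[p --> (\oo, \oo)] --> (0 : R).
  by rewrite -[X in _ --> X](mulr0 (2 : R)); apply: cvgM => //; exact: cvg_cst.
apply: cvg0_le h2 => p; first by apply: (psd_ge0 psd2); split.
have e1 := qa _ (dc p); have e2 := psd_ge0 psd1 (dc p).
have := schrodinger_energyD a (dc p).
rewrite [X in X <= _]qform_shift mul1r -/(qform (inner w) _) => e3.
rewrite -[qform (fval _) _]/(qform (inner w) (s p.1 - s p.2)); lra.
Qed.

(** The inclusion of [fdom (form_add h1 q2)] in [fdom h] is the substantial part and
    comes from [form_sum_dom_closure]; the rest is a passage to the limit. *)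
Lemma closure_form_add :
  [/\ fdom h = fdom (form_add h1 q2) &
    forall u v, fdom h u -> fdom h v -> fval h u v = fval (form_add h1 q2) u v].
Proof.
have [a0 ha0] := semibounded_coercive mu0 q1sb.
have q1a := ha0 a0 (lexx a0); move: a0 q1a {ha0} => a q1a.
have qsb := potential_semibounded; have qa := potential_coercive q1a.
have q2c := @mult_form_closed _ _ _ _ mu0 hV2.
have q2a := @mult_form_coercive _ _ _ _ mu0 hV2.
have clos (W : X -> R) := schrodinger_closable hG hFC W.
have sub : fdom h `<=` fdom (form_add h1 q2).
  move=> u [s su]; have [su1 su2] := form_cvg_split q1a su.
  by split; [exists s|case: (closed_cvg mu0 q2c q2a su2)].
split.
  apply/seteqP; split=> // u [[s su] [uE uW]].
  by apply: (form_sum_dom_closure hG hV hV2 q1sb q1a qsb qa) => //; exists s.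
move=> u v [s su] [t tv].
have [su1 su2] := form_cvg_split q1a su; have [tv1 tv2] := form_cvg_split q1a tv.
have [[uE uW] sQ] := closed_cvg mu0 q2c q2a su2.
have [[vE vW] tQ] := closed_cvg mu0 q2c q2a tv2.
have [_ sc _ _] := su; have [_ tc _ _] := tv.
have energyW (r : nat -> X -> R[i]) z : (forall n, Cc (r n)) -> ell2 mu z -> ell2 w z ->
    qform (shift mu q2 1) (r n - z) @[n --> \oo] --> (0 : R) ->
    qform (inner w) (r n - z) @[n --> \oo] --> (0 : R).
  move=> rc zE zW; apply: cvg0_le => n.
    by apply: (psd_ge0 psdW); apply: (herm_domB hrmW) => //; exact: (Cc_ell2 (rc n)).
  rewrite qform_shift mul1r lerDl (psd_ge0 psdN)//; apply: (herm_domB hrmN) => //.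
  exact: (Cc_ell2 (rc n)).
have l0 := closure_cvg mu0 qsb qa (clos V) su tv.
have l1 := closure_cvg mu0 q1sb q1a (clos V1) su1 tv1.
have l2 : inner w (s n) (t n) @[n --> \oo] --> (inner w u v : R[i]^o).
  apply: (psd_cvg psdW uW vW).
  - by move=> n; exact: (Cc_ell2 (sc n)).
  - by move=> n; exact: (Cc_ell2 (tc n)).
  - exact: energyW.
  - exact: energyW.
have : shift mu h a u v = shift mu h1 a u v + inner w u v.
  apply: (@cvg_unique R[i]^o _ _ _ _ _ l0 _); first exact: norm_hausdorff.
  have -> : (fun n => shift mu q a (s n) (t n)) =
      (fun n => shift mu q1 a (s n) (t n) + inner w (s n) (t n)).
    apply/funext => n; rewrite /shift (schrodinger_formD hG hV (sc n) (tc n)).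
    by rewrite addrAC.
  exact: (@cvgD _ R[i]^o _ _ _ (fun n => shift mu q1 a (s n) (t n)) _ _ _ l1 l2).
by rewrite /shift addrAC => /addIr.
Qed.

End FormSum.

Unset Implicit Arguments.

Theorem theorem2p1 (R : realType) (X : countType)
    (b : X -> X -> R) (mu V V1 V2 : X -> R)
    (hG : weighted_graph b mu)
    (hconn : connected_graph b)
    (hFC : finiteness_condition b mu)
    (hV : forall x, V x = V1 x + V2 x)
    (hV2 : forall x, 0 <= V2 x)
    (hbound : exists C : R, forall u : X -> R[i], Cc u ->
      (C * ell2_norm mu u ^+ 2)%:C <= inner mu (schrodinger b mu V1 u) u) :
  form_sum mu (friedrichs b mu V1) (mult_operator mu V2) = friedrichs b mu V.
Proof.
have [C hC] := hbound.
have mu0 := wg_weight_gt0 hG.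
have q1sb := schrodinger_semibounded hG hC.
have h1c := schrodinger_closure_closed hG hFC q1sb.
have q2c := @mult_form_closed _ _ _ _ mu0 hV2.
have q2op := @mult_form_operator _ _ _ _ mu0 hV2.
have [domE valE] := closure_form_add hG hFC hV hV2 q1sb.
have sumE := form_operator_eq domE valE.
rewrite [RHS]sumE; apply/seteqP; split=> uf.
  move=> [qA [qB [[qAc qAop] [qBc qBop] ufop]]].
  have [domA valA] := closed_form_unique mu0 qAc h1c qAop.
  have [domB valB] := closed_form_unique mu0 qBc q2c (etrans qBop (esym q2op)).
  rewrite (_ : form_operator mu (form_add _ _) = form_operator mu (form_add qA qB))//.
  apply/esym/form_operator_eq; first by rewrite /= domA domB.
  by move=> u v [uA uB] [vA vB] /=; rewrite valA// valB.
move=> ufop; exists (form_closure mu (schrodinger_form b mu V1)), (mult_form mu V2).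
by split; [split; [exact: h1c|exact: erefl]|split; [exact: q2c|exact: q2op]|exact: ufop].
Qed.
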